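(* Let $\alpha$ be a composition of $n$ and let $\mathscr D:=D(\mathcal V_\alpha,\mathrm w_{RB})$. (a) $C_{\mathcal V_\alpha}=\{\Sigma_L(P_{T^x}):T\in\mathsf{ST}(\mathscr D^x)\}$. Furthermore, $$\min C_{\mathcal V_\alpha}=[w_0(\mathrm{set}(\alpha)^c),\mathrm w_{RB}(\mathcal T'_\alpha)]_L\quad\text{and}\quad \max C_{\mathcal V_\alpha}=[\mathrm w_{RB1}(\mathcal T_\alpha),w_1([n-\ell(\alpha)])]_L .$$ (b) $(C_{\mathcal V_\alpha},\preceq)\cong(\mathsf{ST}(\mathscr D^x),\trianglelefteq)$ as posets.
   Context: Permutations. $n$ is a positive integer, $[n]=\{1,\dots,n\}$, $[0]=\emptyset$, $\mathfrak S_n$ the symmetric group (product = composition of maps; permutations written as words), $s_i=(i,i+1)$, $\ell(\sigma)$ Coxeter length, $w_0$ the longest element. $\mathrm{Des}_L(\sigma)=\{i:\ell(s_i\sigma)<\ell(\sigma)\}$, $\mathrm{Des}_R(\sigma)=\{i:\ell(\sigma s_i)<\ell(\sigma)\}$. $\preceq_L$ (resp. $\preceq_R$) has covers $\sigma\prec s_i\sigma$, $i\notin\mathrm{Des}_L(\sigma)$ (resp. $\sigma\prec\sigma s_i$, $i\notin\mathrm{Des}_R(\sigma)$); $[\sigma,\rho]_L$ is the interval for $\preceq_L$. For $S\subseteq[n-1]$, $S^{c}=[n-1]\setminus S$; $w_0(S)$ is the longest element of the subgroup generated by $\{s_i:i\in S\}$; $w_1(S)=w_0w_0(S^c)$ is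 the longest element of $\{z:\mathrm{Des}_R(z)\subseteq S\}$. For a composition $\alpha=(\alpha_1,\dots,\alpha_l)$ of $n$, $\ell(\alpha)=l$ and $\mathrm{set}(\alpha)=\{\alpha_1,\dots,\alpha_1+\dots+\alpha_{l-1}\}$. Classes. For nonempty left weak Bruhat intervals, $I_1\sim_D I_2$ iff there is a poset isomorphism $f:(I_1,\preceq_L)\to(I_2,\preceq_L)$ with $\mathrm{Des}_L(f(\gamma))=\mathrm{Des}_L(\gamma)$ for all $\gamma$. On a class $C$ put $[\sigma,\rho]_L\preceq[\sigma',\rho']_L$ iff $\sigma\preceq_R\sigma'$; it is known that $(C,\preceq)$ has a minimum and a maximum. Diagrams and fillings. Boxes are $(x,y)\in\mathbb Z_{>0}^2$ with $x$ = column from the left, $y$ = row from the bottom. For a diagram $D$ with $n$ boxes and no empty rows/columns, a standard filling is a bijection $F:D\to[n]$; $P_F$ is the poset on $[n]$ with $i\preceq j$ iff $x_i\le x_j$ and $y_i\le y_j$, where $(x_i,y_i)=F^{-1}(i)$; $\Sigma_L(P)=\{\sigma\in\mathfrak S_n:\sigma(i)\le\sigma(j)\text{ whenever }i\preceq_Pj\}$. $\mathsf{ST}(D)$: standard fillings $T$ with $T(i,j)\le T(k,l)$ whenever $i\le k$, $j\le l$, ordered by $T\trianglelefteq U$ iff $\mathrm w_{TL}(T)\preceq_L\mathrm w_{TL}(U)$, where $\mathrm w_{TL}$ reads each column top to bottom, leftmost column first. $D^x$, $T^x$: reflection across the $x$-axis (shifted upward to the first quadrant, touching the axes). Tableaux.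 $\mathrm{tcd}(\alpha)=\{(j,i):1\le i\le\ell(\alpha),1\le j\le\alpha_i\}$. A standard immaculate tableau (SIT) of shape $\alpha$ is a bijective filling of $\mathrm{tcd}(\alpha)$ by $[n]$ with rows increasing left to right and first column increasing bottom to top. $\mathrm w_{RB}$ reads each row right to left, bottom row first. $\mathrm w_{RB1}$ first reads, in each row right to left, bottom row first, all entries not in the first column, and then the first column bottom to top. $\mathcal T_\alpha$ is the SIT filled with $1,\dots,n$ along rows left to right, bottom row first. $\mathcal T'_\alpha$ is the SIT with first column $1,\dots,\ell(\alpha)$ bottom to top and the remaining boxes filled with $\ell(\alpha)+1,\dots,n$ left to right along rows, top row first. $C_{\mathcal V_\alpha}$ is the $\sim_D$-class of $\{\mathrm w_{RB}(T):T\text{ an SIT of shape }\alpha\}$, which is known to be the interval $[w_0(\mathrm{set}(\alpha)^c),\mathrm w_{RB}(\mathcal T'_\alpha)]_L$ ($\mathcal V_\alpha$ is the $H_n(0)$-module on SITs whose quasisymmetric characteristic is the dual immaculate function). $D(\mathcal V_\alpha,\mathrm w_{RB})=\{(i,1):1\le i\le\ell(\alpha)\}\cup\{(i,j+k_i):1\le i\le\ell(\alpha),\,2\le j\le\alpha_i\}$, where $k_{\ell(\alpha)}=0$ and $k_i=\sum_{i<r\le\ell(\alpha)}(\alpha_r-1)$. *)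

(* Defs.v *)
From mathcomp Require Import all_boot all_fingroup.
From mathcomp Require Import finmap zify.

Set Implicit Arguments.
Unset Strict Implicit.
Unset Printing Implicit Defensive.

(* The positive integer of the text is written [n.+1].  The set {1, ..., n+1}
   is ['I_n.+1], where the ordinal [k] stands for the number k+1; likewise the
   index set {1, ..., n} of the simple reflections is ['I_n], where the ordinal
   [k] stands for the index k+1.  Boxes keep their positive coordinates. *)

(* MathComp multiplies permutations from left to right; [pmul s t] is the
   composition of maps [s \o t]. *)
Definition pmul (n : nat) (s t : 'S_n.+1) : 'S_n.+1 := (t * s)%g.

Definition simple_refl (n : nat) (i : 'I_n) : 'S_n.+1 :=
  tperm (inord i) (inord i.+1).

Definition refl_prod (n : nat) (w : seq 'I_n) : 'S_n.+1 :=
  foldr (fun i s => pmul (simple_refl i) s) 1%g w.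

Definition has_expr (n : nat) (s : 'S_n.+1) (k : nat) : bool :=
  [exists w : k.-tuple 'I_n, refl_prod w == s].

Lemma has_expr_ex (n : nat) (s : 'S_n.+1) : exists k, has_expr s k.
Proof.
pose ex (x : 'S_n.+1) := exists w : seq 'I_n, refl_prod w = x.
suff [w <-]: ex s by exists (size w); apply/existsP; exists (in_tuple w).
have exM (x y : 'S_n.+1) : ex x -> ex y -> ex (x * y)%g.
  move=> [v <-] [w <-]; exists (w ++ v).
  by elim: w => [|i w IHw] /=; rewrite ?mulg1 // IHw /pmul mulgA.
have ex1 : ex 1%g by exists [::].
have exs (i : 'I_n) : ex (simple_refl i).
  by exists [:: i]; rewrite /= /pmul mul1g.
have exT d (a : nat) : a + d < n.+1 -> ex (tperm (inord a) (inord (a + d))).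
  elim: d => [|d IHd] lt_ad; first by rewrite addn0 tperm1.
  have lt_ad' : a + d < n by rewrite addnS in lt_ad.
  have exi := exs (Ordinal lt_ad').
  case: (posnP d) => [d0 | d_gt0].
    by move: exi; rewrite /simple_refl /= d0 addn0 addn1.
  have exd : ex (tperm (inord a) (inord (a + d))) by apply: IHd; lia.
  suff -> : tperm (inord a) (inord (a + d.+1)) =
      (simple_refl (Ordinal lt_ad') * (tperm (inord a) (inord (a + d)) *
       simple_refl (Ordinal lt_ad')))%g :> 'S_n.+1 by exact: exM exi (exM _ _ exd exi).
  rewrite /simple_refl /= -{1}[tperm (inord (a + d)) _]tpermV -/(conjg _ _).
  by rewrite tpermJ tpermL tpermD ?addnS // -val_eqE /= !inordK //; lia.
have [ts -> _] := prod_tpermP s.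
elim: ts => [|[x y] ts IHts]; first by rewrite big_nil.
rewrite big_cons; apply: exM IHts => /=.
wlog le_xy : x y / x <= y => [IH|].
  by case: (leqP x y) => [/IH //|/ltnW /IH]; rewrite tpermC.
have := @exT (y - x) x; rewrite subnKC // !inord_val; apply; exact: ltn_ord.
Qed.

Definition coxlen (n : nat) (s : 'S_n.+1) : nat := ex_minn (has_expr_ex s).

Definition DesL (n : nat) (s : 'S_n.+1) : {set 'I_n} :=
  [set i | coxlen (pmul (simple_refl i) s) < coxlen s].

Definition DesR (n : nat) (s : 'S_n.+1) : {set 'I_n} :=
  [set i | coxlen (pmul s (simple_refl i)) < coxlen s].

Definition leL (n : nat) : rel 'S_n.+1 :=
  connect (fun s t => [exists i : 'I_n,
    (i \notin DesL s) && (t == pmul (simple_refl i) s)]).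

Definition leR (n : nat) : rel 'S_n.+1 :=
  connect (fun s t => [exists i : 'I_n,
    (i \notin DesR s) && (t == pmul s (simple_refl i))]).

Definition intervalL (n : nat) (s r : 'S_n.+1) : {set 'S_n.+1} :=
  [set g | leL s g && leL g r].

Definition parabolic (n : nat) (S : {set 'I_n}) : {set 'S_n.+1} :=
  <<[set simple_refl i | i in S]>>%g.

Definition w0 (n : nat) (S : {set 'I_n}) : 'S_n.+1 :=
  [arg max_(s > 1%g in parabolic S) coxlen s].

Definition w1 (n : nat) (S : {set 'I_n}) : 'S_n.+1 :=
  pmul (w0 [set: 'I_n]) (w0 (~: S)).

Definition is_composition (m : nat) (a : seq nat) : bool :=
  (0 \notin a) && (sumn a == m).

(* Parts are numbered from 1. *)
Definition part (a : seq nat) (i : nat) : nat := nth 0 a i.-1.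

Definition comp_set (n : nat) (a : seq nat) : {set 'I_n} :=
  [set i : 'I_n | i.+1 \in [seq sumn (take k a) | k <- iota 1 (size a).-1]].

Definition initial_set (n m : nat) : {set 'I_n} := [set i : 'I_n | i.+1 <= m].

Definition poset_iso (T1 T2 : finType) (A : {set T1}) (le1 : rel T1)
    (B : {set T2}) (le2 : rel T2) (f : T1 -> T2) : bool :=
  [&& [forall x in A, forall y in A, (f x == f y) ==> (x == y)],
      f @: A == B &
      [forall x in A, forall y in A, le2 (f x) (f y) == le1 x y]].

Definition is_intervalL (n : nat) (I : {set 'S_n.+1}) : bool :=
  [exists s : 'S_n.+1, exists r : 'S_n.+1, leL s r && (I == intervalL s r)].

Definition simD (n : nat) (I J : {set 'S_n.+1}) : bool :=
  [exists f : {ffun 'S_n.+1 -> 'S_n.+1},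
    poset_iso I (@leL n) J (@leL n) f &&
    [forall g in I, DesL (f g) == DesL g]].

Definition classD (n : nat) (I : {set 'S_n.+1}) : {set {set 'S_n.+1}} :=
  [set J | is_intervalL J && simD I J].

(* The endpoints of a nonempty interval are unique, so the existential
   quantifiers only name them. *)
Definition le_interval (n : nat) : rel {set 'S_n.+1} := fun I J =>
  [exists s : 'S_n.+1, exists r : 'S_n.+1,
   exists s' : 'S_n.+1, exists r' : 'S_n.+1,
    [&& leL s r, I == intervalL s r, leL s' r', J == intervalL s' r'
      & leR s s']].

Definition is_min (T : finType) (le : rel T) (A : {set T}) (m : T) : Prop :=
  m \in A /\ forall x, x \in A -> le m x.

Definition is_max (T : finType) (le : rel T) (A : {set T}) (m : T) : Prop :=
  m \in A /\ forall x, x \in A -> le x m.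

(* A box is a pair (column, row), both counted from 1. *)
Definition box : Type := (nat * nat)%type.

Notation diagram := {fset nat * nat}.

Notation filling n D := {ffun D -> 'I_n.+1}.

Definition standard (n : nat) (D : diagram) (F : filling n D) : bool :=
  injectiveb F && [forall i, i \in codom F].

Definition box_le (b c : box) : bool := (b.1 <= c.1) && (b.2 <= c.2).

Definition fill_poset (n : nat) (D : diagram) (F : filling n D) :
    rel 'I_n.+1 :=
  fun i j => [exists b : D, exists c : D,
    [&& F b == i, F c == j & box_le (val b) (val c)]].

Definition SigmaL (n : nat) (P : rel 'I_n.+1) : {set 'S_n.+1} :=
  [set s : 'S_n.+1 | [forall i, forall j, P i j ==> (s i <= s j)]].

Definition ST (n : nat) (D : diagram) : {set filling n D} :=
  [set T : filling n D | standard T &&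
    [forall b : D, forall c : D, box_le (val b) (val c) ==> (T b <= T c)]].

Definition height (D : diagram) : nat := \max_(b <- D) b.2.

Definition flip_box (h : nat) (b : box) : box := (b.1, h.+1 - b.2).

Definition flip_diag (D : diagram) : diagram :=
  [fset flip_box (height D) b | b in D]%fset.

Lemma flip_box_in (D : diagram) (c : flip_diag D) :
  (flip_box (height D) (val c) \in D)%fset.
Proof.
case/imfsetP: (valP c) => -[x y] /= Dxy ->; rewrite /flip_box /=.
have le_yh : y <= height D.
  by rewrite /height (big_rem _ Dxy) /= leq_maxl.
by rewrite subKn // leqW.
Qed.

(* The reflection is an involution between [D] and [flip_diag D]. *)
Definition flip_fill (n : nat) (D : diagram) (T : filling n D) :
    filling n (flip_diag D) :=
  [ffun c => T [` flip_box_in c]%fset].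

(* The permutation with one-line notation [w]; the default value is used only
   when [w] is not the word of a permutation. *)
Definition perm_of_word (n : nat) (w : seq 'I_n.+1) : 'S_n.+1 :=
  insubd (1%g : 'S_n.+1) [ffun i : 'I_n.+1 => nth ord0 w i].

Definition boxes (D : diagram) (le : rel box) : seq D :=
  sort (fun b c => le (val b) (val c)) (enum {: D}).

Definition columns_TL : rel box :=
  fun b c => (b.1 < c.1) || (b.1 == c.1) && (c.2 <= b.2).

Definition rows_RB : rel box :=
  fun b c => (b.2 < c.2) || (b.2 == c.2) && (c.1 <= b.1).

Definition rows_LB : rel box :=
  fun b c => (b.2 < c.2) || (b.2 == c.2) && (b.1 <= c.1).

Definition rows_LT : rel box :=
  fun b c => (c.2 < b.2) || (b.2 == c.2) && (b.1 <= c.1).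

Definition in_col1 (D : diagram) (b : D) : bool := (val b).1 == 1.

Definition w_TL (n : nat) (D : diagram) (T : filling n D) : 'S_n.+1 :=
  perm_of_word [seq T b | b <- boxes D columns_TL].

Definition w_RB (n : nat) (D : diagram) (T : filling n D) : 'S_n.+1 :=
  perm_of_word [seq T b | b <- boxes D rows_RB].

Definition w_RB1 (n : nat) (D : diagram) (T : filling n D) : 'S_n.+1 :=
  perm_of_word
    ([seq T b | b <- boxes D rows_RB & ~~ in_col1 b] ++
     [seq T b | b <- boxes D rows_RB & in_col1 b]).

Definition le_ST (n : nat) (D : diagram) : rel (filling n D) :=
  fun T U => leL (w_TL T) (w_TL U).

Definition tcd (a : seq nat) : diagram :=
  [fset b : nat * nat in
    [seq (j, i) | i <- iota 1 (size a), j <- iota 1 (part a i)]]%fset.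

Definition SIT (n : nat) (a : seq nat) : {set filling n (tcd a)} :=
  [set T : filling n (tcd a) | [&& standard T,
    [forall b : tcd a, forall c : tcd a,
      ((val b).2 == (val c).2) && ((val b).1 < (val c).1) ==> (T b < T c)] &
    [forall b : tcd a, forall c : tcd a,
      [&& in_col1 b, in_col1 c & (val b).2 < (val c).2] ==> (T b < T c)]]].

(* Puts the entries 1, 2, 3, ... in the boxes in the order in which [s] lists
   them. *)
Definition fill_along (n : nat) (D : diagram) (s : seq D) : filling n D :=
  [ffun b => inord (index b s)].

Definition tab (n : nat) (a : seq nat) : filling n (tcd a) :=
  fill_along n (boxes (tcd a) rows_LB).

Definition tab' (n : nat) (a : seq nat) : filling n (tcd a) :=
  fill_along n
    ([seq b <- boxes (tcd a) rows_LB | in_col1 b] ++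
     [seq b <- boxes (tcd a) rows_LT | ~~ in_col1 b]).

Definition class_V (n : nat) (a : seq nat) : {set {set 'S_n.+1}} :=
  classD [set w_RB T | T in SIT n a].

Definition shift_V (a : seq nat) (i : nat) : nat :=
  \sum_(i.+1 <= r < (size a).+1) (part a r - 1).

(* [iota 2 (part a i - 1)] lists 2, ..., [part a i]. *)
Definition diag_V (a : seq nat) : diagram :=
  ([fset b : nat * nat in [seq (i, 1) | i <- iota 1 (size a)]] `|`
   [fset b : nat * nat in
     [seq (i, (j + shift_V a i)%N) | i <- iota 1 (size a),
                                     j <- iota 2 (part a i - 1)]])%fset.

(* Main.v *)
(* Number the boxes of D(V_alpha, w_RB) column by column, each column from bottom
   to top.  Fillings then become permutations: [sw_perms] are the fillings U that
   increase to the north-east, [nw_perms] the fillings F that increase to the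
   south-east, and Sigma_L(P_F) = {U o F^-1 : U in sw_perms} =: [fiber F].

   Two boxes not comparable in one of the two orders are comparable in the other,
   so a filling F in [nw_perms] has the same inversions as any other one on the
   incomparable pairs.  Hence [fiber F] is the interval [F^-1, m o F^-1]_L, m being
   the filling that reads the rows upwards, and inversions and descents of U o F^-1
   do not depend on F: entries i and i+1 of U never lie in boxes that are strictly
   north-east of each other, because such boxes have a bottom box between them.
   So all the fibers are in one class.

   Conversely, a cover g < s_i g in the weak order creates exactly one descent, i.
   Hence a descent-preserving isomorphism f of intervals commutes with the s_i
   along covers and is a right translation; applied to a fiber this gives a set
   {U o F^-1 : U in sw_perms} for some filling F, and the descents for U = 1 and
   U = m already force F to increase to the south-east. *)

Require Import Defs.
From mathcomp Require Import all_boot all_fingroup.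
From mathcomp Require Import finmap zify.

Set Implicit Arguments.
Unset Strict Implicit.
Unset Printing Implicit Defensive.

(** * Inversions and the weak orders *)

Lemma chain_rel (T : Type) (r : rel T) (f : nat -> T) (lo hi : nat) :
  transitive r -> lo < hi -> (forall k, lo <= k -> k < hi -> r (f k) (f k.+1)) ->
  r (f lo) (f hi).
Proof.
move=> r_trans; elim: hi => // hi IHhi; rewrite ltnS leq_eqVlt.
case/predU1P => [-> -> //|lt_lh] step; apply: (r_trans (f hi)); last first.
  by apply: step => //; apply: ltnW.
by apply: IHhi => // k le_k lt_k; apply: step => //; apply: ltnW.
Qed.

Lemma pmulE n (s t : 'S_n.+1) x : pmul s t x = s (t x).
Proof. by rewrite /pmul permM. Qed.

Lemma val_simple_refl n (i : 'I_n) (x : 'I_n.+1) :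
  simple_refl i x =
    (if x == i :> nat then i.+1 else if x == i.+1 :> nat then i : nat else x)
    :> nat.
Proof.
have lt_in := ltn_ord i; rewrite /simple_refl.
case: tpermP => [-> | -> | nlo nhi]; rewrite ?inordK ?eqxx //; try lia.
  by rewrite gtn_eqF.
have -> : (x == i :> nat) = false.
  by apply/eqP => e; apply: nlo; apply: val_inj; rewrite /= inordK ?e //; lia.
case: eqP => // e; case: nhi; apply: val_inj; rewrite /= inordK ?e //; lia.
Qed.

Lemma simple_reflK n (i : 'I_n) : (simple_refl i * simple_refl i)%g = 1%g.
Proof. exact: tperm2. Qed.

Lemma simple_reflV n (i : 'I_n) : (simple_refl i)^-1%g = simple_refl i.
Proof. exact: tpermV. Qed.

Lemma pmul_simple_reflK n (i : 'I_n) (s : 'S_n.+1) :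
  pmul (simple_refl i) (pmul (simple_refl i) s) = s.
Proof. by rewrite /pmul -mulgA simple_reflK mulg1. Qed.

Definition pos_lo n (s : 'S_n.+1) (i : 'I_n) : 'I_n.+1 := (s^-1)%g (inord i).
Definition pos_hi n (s : 'S_n.+1) (i : 'I_n) : 'I_n.+1 := (s^-1)%g (inord i.+1).

Lemma perm_pos_lo n (s : 'S_n.+1) (i : 'I_n) : s (pos_lo s i) = i :> nat.
Proof. by rewrite permKV inordK // ltnW // ltnS ltn_ord. Qed.

Lemma perm_pos_hi n (s : 'S_n.+1) (i : 'I_n) : s (pos_hi s i) = i.+1 :> nat.
Proof. by rewrite permKV inordK // ltnS ltn_ord. Qed.

Lemma pos_loE n (s : 'S_n.+1) (i : 'I_n) x : s x = i :> nat -> x = pos_lo s i.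
Proof. by move=> e; apply: (@perm_inj _ s); apply: val_inj; rewrite /= perm_pos_lo. Qed.

Lemma pos_hiE n (s : 'S_n.+1) (i : 'I_n) x : s x = i.+1 :> nat -> x = pos_hi s i.
Proof. by move=> e; apply: (@perm_inj _ s); apply: val_inj; rewrite /= perm_pos_hi. Qed.

Lemma pos_neq n (s : 'S_n.+1) i : pos_lo s i != pos_hi s i :> nat.
Proof.
apply/eqP => /val_inj e; have := perm_pos_lo s i.
by rewrite e perm_pos_hi => /eqP; rewrite eqn_leq ltnn.
Qed.

Lemma pos_lo_refl n (s : 'S_n.+1) i : pos_lo (pmul (simple_refl i) s) i = pos_hi s i.
Proof.
apply/esym/pos_loE; rewrite pmulE val_simple_refl perm_pos_hi eqxx.
by rewrite gtn_eqF.
Qed.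

Lemma pos_hi_refl n (s : 'S_n.+1) i : pos_hi (pmul (simple_refl i) s) i = pos_lo s i.
Proof. by apply/esym/pos_hiE; rewrite pmulE val_simple_refl perm_pos_lo eqxx. Qed.

Definition Inv n (s : 'S_n.+1) : {set 'I_n.+1 * 'I_n.+1} :=
  [set pq : 'I_n.+1 * 'I_n.+1 | (pq.1 < pq.2) && (s pq.2 < s pq.1)].

Lemma Inv1 n : Inv (1%g : 'S_n.+1) = set0.
Proof. by apply/setP => -[x y]; rewrite !inE /= !perm1; case: ltngtP. Qed.

Lemma Inv_refl_up n (s : 'S_n.+1) (i : 'I_n) :
  pos_lo s i < pos_hi s i ->
  Inv (pmul (simple_refl i) s) = (pos_lo s i, pos_hi s i) |: Inv s.
Proof.
move=> lt_lh; apply/setP => -[x y]; rewrite !inE /= !pmulE xpair_eqE.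
rewrite !val_simple_refl.
have [-> | nx] := eqVneq x (pos_lo s i).
  have [-> | ny] := eqVneq y (pos_hi s i).
    by rewrite lt_lh perm_pos_lo perm_pos_hi eqxx gtn_eqF // eqxx ltnSn.
  have nsy : s y != i.+1 :> nat by apply: contraNneq ny => /pos_hiE ->.
  rewrite perm_pos_lo /= eqxx; case: (ltnP _ y) => //= lt_ly.
  have nsy' : s y != i :> nat.
    by apply: contraTneq lt_ly => /pos_loE ->; rewrite ltnn.
  by rewrite (negbTE nsy) (negbTE nsy'); lia.
have nsx : s x != i :> nat by apply: contraNneq nx => /pos_loE ->.
rewrite (negbTE nsx) /=; case: (ltnP x y) => //= lt_xy.
have [sx | nsx'] := eqVneq (s x : nat) i.+1.
  case: (eqVneq (s y : nat) i) => [sy | nsy].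
    by move: lt_xy lt_lh; rewrite (pos_hiE sx) (pos_loE sy); lia.
  case: (eqVneq (s y : nat) i.+1) => [sy | nsy']; last by lia.
  by move: lt_xy; rewrite (pos_hiE sx) (pos_hiE sy) ltnn.
by case: eqP; [|case: eqP]; lia.
Qed.

Lemma card_Inv_up n (s : 'S_n.+1) (i : 'I_n) :
  pos_lo s i < pos_hi s i -> #|Inv (pmul (simple_refl i) s)| = #|Inv s|.+1.
Proof.
move=> lt_lh; rewrite Inv_refl_up // cardsU1 inE /= lt_lh /=.
by rewrite perm_pos_lo perm_pos_hi ltnNge leqnSn.
Qed.

Lemma card_Inv_down n (s : 'S_n.+1) (i : 'I_n) :
  pos_hi s i < pos_lo s i -> #|Inv s| = #|Inv (pmul (simple_refl i) s)|.+1.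
Proof.
move=> lt_hl; rewrite -[in LHS](pmul_simple_reflK i s) card_Inv_up //.
by rewrite pos_lo_refl pos_hi_refl.
Qed.

Lemma perm_rank n (s : 'S_n.+1) (y : 'I_n.+1) : #|[set x | s x < s y]| = s y.
Proof.
have cardlt (z : 'I_n.+1) : #|[set x : 'I_n.+1 | x < z]| = z.
  by rewrite -sum1dep_card (big_ord_narrow (ltnW (ltn_ord z))) sum1_card card_ord.
apply: etrans (cardlt (s y)); apply: etrans (card_preimset _ (@perm_inj _ s)).
by apply: eq_card => x; rewrite !inE.
Qed.

Lemma perm_increasing n (s : 'S_n.+1) :
  (forall x y : 'I_n.+1, x < y -> s x < s y) -> s = 1%g.
Proof.
move=> s_incr; have mono x y : (s x < s y) = (x < y).
  apply/idP/idP => [|/s_incr //]; case: (ltngtP x y) => // [/s_incr|/val_inj ->].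
    by case: ltngtP.
  by rewrite ltnn.
apply/permP => y; apply: val_inj; rewrite /= -[LHS]perm_rank -[RHS]perm_rank.
by apply: eq_card => x; rewrite !inE /= mono !perm1.
Qed.

Lemma perm_order_inj n (s t : 'S_n.+1) :
  (forall x y : 'I_n.+1, s x < s y -> t x < t y) -> s = t.
Proof.
move=> st; apply/eqP; rewrite eq_mulVg1; apply/eqP/perm_increasing => x y lt_xy.
by rewrite !permM st // !permKV.
Qed.

Lemma perm_increasing_step n (s : 'S_n.+1) :
  (forall i : 'I_n, s (inord i) < s (inord i.+1)) -> s = 1%g.
Proof.
move=> step; apply: perm_increasing => x y lt_xy.
rewrite -(inord_val x) -(inord_val y).
apply: (@chain_rel _ ltn (fun k => s (inord k) : nat)) => //.
  by move=> b a c; apply: ltn_trans.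
move=> k _ lt_ky; have lt_kn : k < n by have := ltn_ord y; lia.
exact: (step (Ordinal lt_kn)).
Qed.

Lemma has_expr_Inv n (s : 'S_n.+1) : has_expr s #|Inv s|.
Proof.
move: {2}#|Inv s| (erefl #|Inv s|) => k; elim: k s => [|k IHk] s card_s.
  suff -> : s = 1%g.
    by rewrite Inv1 cards0; apply/existsP; exists [tuple]; rewrite /refl_prod.
  apply: perm_increasing => x y lt_xy; rewrite ltnNge leq_eqVlt; apply/negP.
  case/orP => [/eqP/val_inj/perm_inj e|gt]; first by rewrite e ltnn in lt_xy.
  have : (x, y) \in Inv s by rewrite inE /= lt_xy gt.
  by rewrite (cards0_eq card_s) inE.
have [i lt_i | noi] := pickP (fun i : 'I_n => pos_hi s i < pos_lo s i).
  have := card_Inv_down lt_i; rewrite card_s => -[/esym card_s'].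
  have := IHk _ card_s'; rewrite card_s' => /existsP[w /eqP def_w].
  apply/existsP; exists [tuple of i :: w]; apply/eqP => /=; rewrite def_w.
  exact: pmul_simple_reflK.
have s1 : s^-1%g = 1%g.
  apply: perm_increasing_step => i; have := noi i; have := pos_neq s i.
  by rewrite /pos_lo /pos_hi; lia.
move: card_s; rewrite -[s]invgK s1 invg1.
by rewrite Inv1 cards0.
Qed.

Lemma coxlenE n (s : 'S_n.+1) : coxlen s = #|Inv s|.
Proof.
rewrite /coxlen; case: ex_minnP => k expr_k min_k; apply/eqP.
rewrite eqn_leq min_k ?has_expr_Inv //= {min_k}.
case/existsP: expr_k => w /eqP <-; rewrite -[X in _ <= X](size_tuple w).
rewrite /refl_prod; elim: {w}(tval w) => [|i w IHw] /=.
  by rewrite leqn0 cards_eq0 Inv1.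
move: (foldr _ _ w) IHw => u IHw; have := pos_neq u i; rewrite neq_ltn.
case/orP => [/card_Inv_up ->|/card_Inv_down e] //.
by apply: leq_trans (leqW IHw); rewrite e ltnW.
Qed.

Lemma DesLE n (s : 'S_n.+1) (i : 'I_n) : (i \in DesL s) = (pos_hi s i < pos_lo s i).
Proof.
rewrite inE !coxlenE; have := pos_neq s i.
by rewrite neq_ltn => /orP[lt|lt]; 
  [rewrite (card_Inv_up lt)|rewrite (card_Inv_down lt)]; lia.
Qed.

Lemma DesL_lt n (s : 'S_n.+1) (i : 'I_n) x y :
  s x = i :> nat -> s y = i.+1 :> nat -> (i \in DesL s) = (y < x).
Proof. by move=> /pos_loE -> /pos_hiE ->; rewrite DesLE. Qed.

Lemma notin_DesL n (s : 'S_n.+1) (i : 'I_n) :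
  (i \notin DesL s) = (pos_lo s i < pos_hi s i).
Proof. by rewrite DesLE; have := pos_neq s i; lia. Qed.

Lemma card_Inv_inv n (s : 'S_n.+1) : #|Inv s^-1%g| = #|Inv s|.
Proof.
pose h (pq : 'I_n.+1 * 'I_n.+1) := ((s^-1)%g pq.2, (s^-1)%g pq.1).
have h_inj : injective h by case=> a b [c d] [/perm_inj -> /perm_inj ->].
rewrite -(card_preimset (Inv s) h_inj); apply: eq_card => -[x y].
by rewrite !inE /= !permKV andbC.
Qed.

Lemma DesR_inv n (s : 'S_n.+1) : DesR s = DesL s^-1%g.
Proof.
apply/setP => i; rewrite !inE !coxlenE card_Inv_inv -card_Inv_inv.
by rewrite /pmul invMg simple_reflV.
Qed.


Lemma Inv_sub_lt n (s t : 'S_n.+1) (x y : 'I_n.+1) :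
  Inv s \subset Inv t -> x < y -> s y < s x -> t y < t x.
Proof.
move=> /subsetP/(_ (x, y)); rewrite !inE /= => st lt_xy lt_s.
by move: st; rewrite lt_xy lt_s => /(_ isT).
Qed.

Lemma Inv_inj n : injective (@Inv n).
Proof.
move=> s t eq_st; apply: perm_order_inj => x y lt_s.
case: (ltngtP x y) => [lt_xy|lt_yx|/val_inj e]; last by rewrite e ltnn in lt_s.
  rewrite ltnNge leq_eqVlt; apply/negP => /orP[/eqP/val_inj/perm_inj e|].
    by rewrite e ltnn in lt_xy.
  have st : Inv t \subset Inv s by rewrite eq_st.
  by move/(Inv_sub_lt st lt_xy); case: ltngtP lt_s.
by apply: (Inv_sub_lt _ lt_yx lt_s); rewrite eq_st.
Qed.

Lemma leLP n (s t : 'S_n.+1) : leL s t = (Inv s \subset Inv t).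
Proof.
apply/idP/idP => [/connectP[p pth ->] | sub_st].
  elim: p s pth => [|u p IHp] s //= /andP[/existsP[i /andP[]]].
  rewrite notin_DesL => lt_i /eqP -> /IHp; apply: subset_trans.
  by rewrite Inv_refl_up // subsetUr.
move: {2}(#|Inv t| - #|Inv s|) (leqnn (#|Inv t| - #|Inv s|)) => k.
elim: k s sub_st => [|k IHk] s sub_st le_k.
  suff -> : s = t by apply: connect0.
  apply: Inv_inj; apply/eqP; by rewrite eqEcard sub_st -subn_eq0 -leqn0.
have [->|neq_st] := eqVneq s t; first exact: connect0.
have [i /andP[lt_i lt_ti] | noi] := pickP (fun i : 'I_n =>
  (pos_lo s i < pos_hi s i) && (t (pos_hi s i) < t (pos_lo s i))).
  apply: (connect_trans (y := pmul (simple_refl i) s)).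
    by apply: connect1; apply/existsP; exists i; rewrite notin_DesL lt_i eqxx.
  apply: IHk; last by rewrite card_Inv_up // subnS -subn1 leq_subLR.
  by rewrite Inv_refl_up // subUset sub1set inE /= lt_i lt_ti sub_st.
case/eqP: neq_st; apply/eqP; rewrite eq_mulVg1; apply/eqP/perm_increasing_step => i.
rewrite !permM -/(pos_lo s i) -/(pos_hi s i).
have := pos_neq s i; rewrite neq_ltn => /orP[lt_i|gt_i].
  have := noi i; rewrite lt_i /= => /negbT; rewrite -leqNgt leq_eqVlt.
  by case/orP => // /eqP/val_inj/perm_inj e; have := pos_neq s i; rewrite e eqxx.
by apply: (Inv_sub_lt sub_st gt_i); rewrite perm_pos_lo perm_pos_hi.
Qed.

Lemma leL_refl n (s : 'S_n.+1) : leL s s.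
Proof. exact: connect0. Qed.

Lemma leL_trans n : transitive (@leL n).
Proof. by move=> y x z; apply: connect_trans. Qed.

Lemma leL_anti n : antisymmetric (@leL n).
Proof.
by move=> s t; rewrite !leLP -eqEsubset => /eqP; apply: Inv_inj.
Qed.

Lemma connect_homo (T T' : finType) (e : rel T) (e' : rel T') (h : T -> T') :
  {homo h : x y / e x y >-> e' x y} ->
  {homo h : x y / connect e x y >-> connect e' x y}.
Proof.
move=> h_homo x _ /connectP[p pth ->]; elim: p x pth => [|y p IHp] x //=.
case/andP => /h_homo /connect1; move=> e_xy /IHp; exact: connect_trans.
Qed.

Lemma leRE n (s t : 'S_n.+1) : leR s t = leL s^-1%g t^-1%g.
Proof.
have stepE (u v : 'S_n.+1) :
    [exists i : 'I_n, (i \notin DesR u) && (v == pmul u (simple_refl i))] =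
    [exists i : 'I_n, (i \notin DesL u^-1%g) &&
                      (v^-1%g == pmul (simple_refl i) u^-1%g)].
  apply: eq_existsb => i; rewrite DesR_inv; congr (_ && _).
  by rewrite /pmul -[X in (_^-1 * X)%g]simple_reflV -invMg (inj_eq invg_inj).
apply/idP/idP => [|le_st]; first by apply: connect_homo => u v; rewrite (stepE u v).
rewrite -[s]invgK -[t]invgK; move: le_st; apply: connect_homo => u v.
by rewrite (stepE u^-1%g v^-1%g) !invgK.
Qed.

Lemma leL_step n (s : 'S_n.+1) (i : 'I_n) :
  i \notin DesL s -> leL s (pmul (simple_refl i) s).
Proof. by move=> di; apply/connect1/existsP; exists i; rewrite di /=. Qed.

Lemma leL_first_step n (s t : 'S_n.+1) : leL s t -> s != t ->
  exists2 i : 'I_n, i \notin DesL s & leL (pmul (simple_refl i) s) t.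
Proof.
case/connectP=> -[|u p] /= => [_ ->|]; first by rewrite eqxx.
case/andP=> /existsP[i /andP[di /eqP ->]] pth -> _; exists i => //.
by apply/connectP; exists p.
Qed.

Lemma leL_cover n (s t : 'S_n.+1) (i : 'I_n) : i \notin DesL s ->
  leL s t -> leL t (pmul (simple_refl i) s) -> s != t ->
  t = pmul (simple_refl i) s.
Proof.
rewrite notin_DesL => lt_i le_st le_ts neq_st.
apply: Inv_inj; apply/eqP; rewrite eqEcard -leLP le_ts card_Inv_up //=.
apply: proper_card; rewrite properEneq -leLP le_st andbT.
by rewrite (inj_eq (@Inv_inj n)).
Qed.

(* A cover in the left weak order may destroy descents next to [i], but creates
   only the descent [i]. *)
Lemma DesL_step n (s : 'S_n.+1) (i j : 'I_n) :
  i \notin DesL s -> j \notin DesL s ->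
  (j \in DesL (pmul (simple_refl i) s)) = (j == i).
Proof.
move=> di dj; have [-> | neq_ji] := eqVneq j i.
  by rewrite DesLE pos_lo_refl pos_hi_refl -notin_DesL.
have neq_ij : j != i :> nat by [].
move: di dj; rewrite !notin_DesL => di dj.
set t := pmul _ _.
have [e | nei] := eqVneq (j : nat) i.+1.
  have hj : t (pos_hi s j) = j.+1 :> nat.
    by rewrite pmulE val_simple_refl perm_pos_hi; case: eqP => [|_]; [lia|case: eqP; lia].
  have lj : t (pos_lo s i) = j :> nat.
    by rewrite pmulE val_simple_refl perm_pos_lo eqxx.
  have ij : pos_hi s i = pos_lo s j by apply: pos_loE; rewrite perm_pos_hi.
  by rewrite (DesL_lt lj hj); apply/negbTE; rewrite -leqNgt ltnW //; rewrite ij in di; lia.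
have [e | nej] := eqVneq (i : nat) j.+1.
  have hj : t (pos_hi s i) = j.+1 :> nat.
    by rewrite pmulE val_simple_refl perm_pos_hi gtn_eqF // eqxx.
  have lj : t (pos_lo s j) = j :> nat.
    by rewrite pmulE val_simple_refl perm_pos_lo; case: eqP => [|_]; [lia|case: eqP; lia].
  have ij : pos_hi s j = pos_lo s i by apply: pos_loE; rewrite perm_pos_hi.
  by rewrite (DesL_lt lj hj); apply/negbTE; rewrite -leqNgt ltnW //; rewrite ij in dj; lia.
have hj : t (pos_hi s j) = j.+1 :> nat.
  by rewrite pmulE val_simple_refl perm_pos_hi; case: eqP => [|_]; [lia|case: eqP; lia].
have lj : t (pos_lo s j) = j :> nat.
  by rewrite pmulE val_simple_refl perm_pos_lo; case: eqP => [|_]; [lia|case: eqP; lia].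
by rewrite (DesL_lt lj hj); apply/negbTE; rewrite -leqNgt ltnW.
Qed.

Lemma in_intervalL n (s r g : 'S_n.+1) : (g \in intervalL s r) = leL s g && leL g r.
Proof. by rewrite inE. Qed.

Lemma poset_isoP (T1 T2 : finType) (A : {set T1}) (le1 : rel T1)
    (B : {set T2}) (le2 : rel T2) (f : T1 -> T2) :
  reflect [/\ {in A &, injective f}, f @: A = B &
              {in A &, forall x y, le2 (f x) (f y) = le1 x y}]
          (poset_iso A le1 B le2 f).
Proof.
apply: (iffP and3P) => -[f_inj f_im f_le]; split.
- move=> x y Ax Ay e; move/forall_inP/(_ x Ax)/forall_inP/(_ y Ay): f_inj.
  by rewrite e eqxx => /eqP.
- exact/eqP.
- by move=> x y Ax Ay; move/forall_inP/(_ x Ax)/forall_inP/(_ y Ay)/eqP: f_le.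
- apply/forall_inP => x Ax; apply/forall_inP => y Ay; apply/implyP => /eqP e.
  by apply/eqP/f_inj.
- exact/eqP.
by apply/forall_inP => x Ax; apply/forall_inP => y Ay; rewrite f_le.
Qed.

Lemma poset_iso_translate n (s r s' r' : 'S_n.+1) (f : 'S_n.+1 -> 'S_n.+1) :
  leL s r -> poset_iso (intervalL s r) (@leL n) (intervalL s' r') (@leL n) f ->
  {in intervalL s r, forall g, DesL (f g) = DesL g} ->
  {in intervalL s r, forall g, f g = (f s * s^-1 * g)%g}.
Proof.
move=> le_sr /poset_isoP[f_inj f_im f_le] f_des g; rewrite in_intervalL.
case/andP => /connectP[p pth ->]; elim/last_ind: p pth => [|p z IHp] /=.
  by move=> _ _; rewrite mulgKV.
rewrite rcons_path last_rcons => /andP[pth]; set y := last s p in pth *.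
case/existsP => i /andP[di /eqP ->] le_zr; set z' := pmul _ _ in le_zr *.
have le_sy : leL s y by apply/connectP; exists p.
have le_yz : leL y z' by apply: leL_step.
have le_yr := leL_trans le_yz le_zr.
have Iy : y \in intervalL s r by rewrite in_intervalL le_sy.
have Iz : z' \in intervalL s r by rewrite in_intervalL (leL_trans le_sy).
have Jy : f y \in intervalL s' r' by rewrite -f_im imset_f.
have Jz : f z' \in intervalL s' r' by rewrite -f_im imset_f.
have neq_yz : y != z'.
  apply: contraNneq (di) => e; rewrite [y in DesL y]e.
  by rewrite DesLE pos_lo_refl pos_hi_refl -notin_DesL.
have [j dj le_jz] : exists2 j : 'I_n, j \notin DesL (f y) &
    leL (pmul (simple_refl j) (f y)) (f z').
  apply: leL_first_step; first by rewrite f_le.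
  by apply: contra_neq neq_yz => e; apply: f_inj e.
have le_yj := leL_step dj.
have : pmul (simple_refl j) (f y) \in intervalL s' r'.
  move: Jy Jz; rewrite !in_intervalL => /andP[le1 _] /andP[_ le2].
  by rewrite (leL_trans le1 le_yj) (leL_trans le_jz le2).
rewrite -f_im => /imsetP[x Ix def_x].
have neq_yx : y != x.
  apply: contraNneq (dj) => e; rewrite [y in f y]e -def_x.
  by rewrite DesLE pos_lo_refl pos_hi_refl -notin_DesL.
have def_z : x = z'.
  by apply: leL_cover; rewrite // -f_le // -def_x.
have eq_ij : i = j.
  apply/eqP; rewrite -(DesL_step dj); last by rewrite f_des.
  by rewrite def_x f_des // def_z DesLE pos_lo_refl pos_hi_refl -notin_DesL.
rewrite -def_z -def_x def_z /z' -eq_ij /pmul mulgA; congr (_ * _)%g.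
by apply: IHp.
Qed.

(** * Longest elements of parabolic subgroups *)

(* The permutation that reverses each maximal block of consecutive integers joined
   by elements of [S]. *)
Definition block_rev n (S : {set 'I_n}) (v : 'S_n.+1) : Prop :=
  (forall i : 'I_n, i \in S -> v (inord i.+1) < v (inord i)) /\
  (forall (c : 'I_n) (x y : 'I_n.+1), c \notin S -> x <= c -> c < y -> v x < v y).

Lemma block_rev_gt n (S : {set 'I_n}) (v : 'S_n.+1) (x y : 'I_n.+1) :
  block_rev S v -> x < y -> (forall c : 'I_n, x <= c -> c < y -> c \in S) ->
  v y < v x.
Proof.
move=> [vS _] lt_xy xyS.
have := @chain_rel _ (fun a b => b < a) (fun k => v (inord k) : nat) x y.
rewrite /= !inord_val; apply=> //.
  by move=> b a c lt_ba lt_cb; apply: ltn_trans lt_cb lt_ba.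
move=> k le_xk lt_ky; have lt_kn : k < n by have := ltn_ord y; lia.
by apply: (vS (Ordinal lt_kn)); apply: xyS.
Qed.

Lemma block_rev_inj n (S : {set 'I_n}) (u v : 'S_n.+1) :
  block_rev S u -> block_rev S v -> u = v.
Proof.
move=> Su Sv; apply: perm_order_inj => x y lt_u.
case: (ltngtP x y) => [lt_xy|lt_yx|/val_inj e]; last by rewrite e ltnn in lt_u.
  have [c /and3P[nSc le_xc lt_cy] | noc] :=
      pickP (fun c : 'I_n => [&& c \notin S, x <= c & c < y]).
    exact: Sv.2 nSc le_xc lt_cy.
  suff : u y < u x by case: ltngtP lt_u.
  apply: block_rev_gt Su lt_xy _ => c le_xc lt_cy.
  by have := noc c; rewrite le_xc lt_cy !andbT => /negbFE.
apply: block_rev_gt Sv lt_yx _ => c le_yc lt_cx; apply: contraLR lt_u => nSc.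
by rewrite -leqNgt ltnW // (Su.2 c).
Qed.

Lemma parabolic_le n (S : {set 'I_n}) (g : 'S_n.+1) (c : 'I_n) x :
  g \in parabolic S -> c \notin S -> (g x <= c) = (x <= c).
Proof.
move=> Sg nSc; pose H := [set h : 'S_n.+1 | [forall z, (h z <= c) == (z <= c)]].
have gH : group_set H.
  apply/group_setP; split=> [|h k]; rewrite !inE.
    by apply/forallP => z; rewrite perm1.
  move=> /forallP hP /forallP kP; apply/forallP => z.
  by rewrite permM (eqP (kP (h z))) (eqP (hP z)).
suff : parabolic S \subset Group gH.
  by move/subsetP/(_ g Sg); rewrite inE => /forallP/(_ x)/eqP.
rewrite gen_subG; apply/subsetP => _ /imsetP[i Si ->]; rewrite inE.
have neq_ic : i != c :> nat by apply: contraNneq nSc => /val_inj <-.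
apply/forallP => z; apply/eqP; rewrite val_simple_refl.
by case: (z =P i :> nat) => [|_]; [|case: (z =P i.+1 :> nat)]; lia.
Qed.

Lemma block_rev_max n (S : {set 'I_n}) (g : 'S_n.+1) :
  g \in parabolic S -> (forall h, h \in parabolic S -> coxlen h <= coxlen g) ->
  block_rev S g.
Proof.
move=> Sg max_g; split=> [i Si | c x y nSc le_xc lt_cy]; last first.
  by have := parabolic_le x Sg nSc; have := parabolic_le y Sg nSc; lia.
rewrite ltnNge leq_eqVlt; apply/negP => /orP[/eqP/val_inj/perm_inj/(congr1 val) | lt_g].
  by have lt_in := ltn_ord i; rewrite /= !inordK //; lia.
have Sh : (g^-1 * simple_refl i)^-1%g \in parabolic S.
  by rewrite groupV groupM ?groupV // mem_gen ?imset_f.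
have := max_g _ Sh; rewrite !coxlenE card_Inv_inv -/(pmul _ _) card_Inv_up.
  by rewrite card_Inv_inv ltnn.
by rewrite /pos_lo /pos_hi invgK.
Qed.

Lemma w0P n (S : {set 'I_n}) : w0 S \in parabolic S /\
  (forall h, h \in parabolic S -> coxlen h <= coxlen (w0 S)).
Proof.
rewrite /w0; case: arg_maxnP => [|g Sg max_g]; first exact: group1.
by split.
Qed.

Lemma block_rev_w0 n (S : {set 'I_n}) : block_rev S (w0 S).
Proof. by have [Sw max_w] := w0P S; apply: block_rev_max. Qed.

Lemma w0V n (S : {set 'I_n}) : (w0 S)^-1%g = w0 S.
Proof.
have [Sw max_w] := w0P S; apply: block_rev_inj (block_rev_w0 S).
apply: block_rev_max => [|h /max_w]; first by rewrite groupV.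
by rewrite !coxlenE card_Inv_inv.
Qed.

(** * Fillings as permutations *)

Definition rank_perm n (lt : rel 'I_n.+1) : 'S_n.+1 :=
  insubd (1%g : 'S_n.+1) [ffun k => inord #|[set k' | lt k' k]|].

Lemma rank_permE n (lt : rel 'I_n.+1) (x : 'I_n.+1) :
  irreflexive lt -> transitive lt -> (forall x y, x != y -> lt x y || lt y x) ->
  rank_perm lt x = #|[set k | lt k x]| :> nat.
Proof.
move=> lt_irr lt_tr lt_tot.
have rank_lt y : #|[set k | lt k y]| < n.+1.
  suff /proper_card : [set k | lt k y] \proper setT by rewrite cardsT card_ord.
  rewrite properT.
  by apply: contraTneq (in_setT y) => <-; rewrite inE lt_irr.
have rank_mono y z : lt y z -> #|[set k | lt k y]| < #|[set k | lt k z]|.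
  move=> lt_yz; apply: proper_card; apply/properP; split.
    by apply/subsetP => k; rewrite !inE => /lt_tr; apply.
  by exists y; rewrite !inE ?lt_irr.
rewrite -pvalE insubdK ?ffunE ?inordK //; apply/injectiveP => y z.
rewrite !ffunE => /(congr1 val); rewrite /= !inordK // => e.
by apply/eqP; apply/idPn => /lt_tot /orP[] /rank_mono; rewrite e ltnn.
Qed.

Lemma rank_perm_lt n (lt : rel 'I_n.+1) (x y : 'I_n.+1) :
  irreflexive lt -> transitive lt -> (forall x y, x != y -> lt x y || lt y x) ->
  (rank_perm lt x < rank_perm lt y) = lt x y.
Proof.
move=> lt_irr lt_tr lt_tot.
have rank_mono z t : lt z t -> rank_perm lt z < rank_perm lt t.
  move=> lt_zt; rewrite !rank_permE //; apply: proper_card; apply/properP; split.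
    by apply/subsetP => k; rewrite !inE => /lt_tr; apply.
  by exists z; rewrite !inE ?lt_irr.
apply/idP/idP => [lt_s|/rank_mono //]; have [e|/lt_tot/orP[]//] := eqVneq x y.
  by rewrite e ltnn in lt_s.
by move/rank_mono; case: ltngtP lt_s.
Qed.

(* [cl k] is the column of the box numbered [k]; its bottom box is the one with the
   smallest number. *)
Definition hd n (cl : 'I_n.+1 -> nat) (k : 'I_n.+1) : bool :=
  [forall k' : 'I_n.+1, (cl k' == cl k) ==> (k <= k')].

(* [sw]: the first box is weakly south-west of the second; [nw]: weakly north-west.
   Boxes other than the bottom ones lie lower the further right their column is. *)
Definition sw n (cl : 'I_n.+1 -> nat) : rel 'I_n.+1 := fun k k' =>
  hd cl k && (cl k <= cl k') || (cl k == cl k') && (k <= k').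

Definition nw n (cl : 'I_n.+1 -> nat) : rel 'I_n.+1 := fun k k' =>
  (cl k < cl k') && (hd cl k ==> hd cl k') || (cl k == cl k') && (k' <= k).

Definition sw_perms n (cl : 'I_n.+1 -> nat) : {set 'S_n.+1} := SigmaL (sw cl).
Definition nw_perms n (cl : 'I_n.+1 -> nat) : {set 'S_n.+1} := SigmaL (nw cl).

Definition fiber n (cl : 'I_n.+1 -> nat) (F : 'S_n.+1) : {set 'S_n.+1} :=
  [set s | (F * s)%g \in sw_perms cl].

(* Columns left to right, each read downwards. *)
Definition lt_cols n (cl : 'I_n.+1 -> nat) : rel 'I_n.+1 := fun k k' =>
  (cl k < cl k') || (cl k == cl k') && (k' < k).

(* Rows upwards, respectively downwards, each read left to right: a row that is not
   the bottom one lies in a single column. *)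
Definition lt_rows_up n (cl : 'I_n.+1 -> nat) : rel 'I_n.+1 := fun k k' =>
  if hd cl k == hd cl k' then (if hd cl k then k < k' else lt_cols cl k' k)
  else hd cl k.

Definition lt_rows_down n (cl : 'I_n.+1 -> nat) : rel 'I_n.+1 := fun k k' =>
  if hd cl k == hd cl k' then (if hd cl k then k < k' else lt_cols cl k k')
  else hd cl k'.

Definition cols_perm n (cl : 'I_n.+1 -> nat) := rank_perm (lt_cols cl).
Definition rows_up n (cl : 'I_n.+1 -> nat) := rank_perm (lt_rows_up cl).
Definition rows_down n (cl : 'I_n.+1 -> nat) := rank_perm (lt_rows_down cl).

Lemma cols_perm_lt n (cl : 'I_n.+1 -> nat) k k' :
  (cols_perm cl k < cols_perm cl k') = lt_cols cl k k'.
Proof.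
apply: rank_perm_lt => [x|y x z|x y neq_xy]; rewrite /lt_cols; try lia.
by have : x != y :> nat by []; lia.
Qed.

Lemma rows_up_lt n (cl : 'I_n.+1 -> nat) k k' :
  (rows_up cl k < rows_up cl k') = lt_rows_up cl k k'.
Proof.
apply: rank_perm_lt => [x|y x z|x y neq_xy]; rewrite /lt_rows_up /lt_cols.
- by case: (hd cl x) => /=; lia.
- by case: (hd cl x); case: (hd cl y); case: (hd cl z) => //=; lia.
have : x != y :> nat by [].
by case: (hd cl x); case: (hd cl y) => //=; lia.
Qed.

Lemma rows_down_lt n (cl : 'I_n.+1 -> nat) k k' :
  (rows_down cl k < rows_down cl k') = lt_rows_down cl k k'.
Proof.
apply: rank_perm_lt => [x|y x z|x y neq_xy]; rewrite /lt_rows_down /lt_cols.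
- by case: (hd cl x) => /=; lia.
- by case: (hd cl x); case: (hd cl y); case: (hd cl z) => //=; lia.
have : x != y :> nat by [].
by case: (hd cl x); case: (hd cl y) => //=; lia.
Qed.

Definition monotone n (cl : 'I_n.+1 -> nat) : Prop :=
  forall x y : 'I_n.+1, x <= y -> cl x <= cl y.

Lemma hd_le n (cl : 'I_n.+1 -> nat) (k k' : 'I_n.+1) :
  hd cl k -> cl k' = cl k -> k <= k'.
Proof. by move=> /forallP/(_ k') /implyP hk e; apply: hk; rewrite e. Qed.

Lemma hd_ex n (cl : 'I_n.+1 -> nat) (k : 'I_n.+1) :
  exists2 h : 'I_n.+1, hd cl h & cl h = cl k.
Proof.
have [h /eqP eq_hk min_h] := @arg_minnP _ k (fun h => cl h == cl k) val (eqxx _).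
exists h => //; apply/forallP => k'; apply/implyP; rewrite eq_hk; exact: min_h.
Qed.

Lemma SigmaLP n (P : rel 'I_n.+1) (s : 'S_n.+1) :
  reflect (forall i j, P i j -> s i <= s j) (s \in SigmaL P).
Proof.
rewrite inE; apply: (iffP forallP) => [H i j|H i].
  by move/forallP: (H i) => /(_ j) /implyP.
by apply/forallP => j; apply/implyP; apply: H.
Qed.

Lemma nw_total n (cl : 'I_n.+1 -> nat) (k k' : 'I_n.+1) : monotone cl ->
  ~~ sw cl k k' -> ~~ sw cl k' k -> nw cl k k' || nw cl k' k.
Proof.
rewrite /sw /nw => mono; case: (hd cl k); case: (hd cl k') => //=; lia.
Qed.

Lemma mono_lt n (cl : 'I_n.+1 -> nat) (k k' : 'I_n.+1) : monotone cl ->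
  cl k < cl k' -> k < k'.
Proof. by move=> mono; apply: contraTT; rewrite -!leqNgt => /mono. Qed.

Lemma sw_le n (cl : 'I_n.+1 -> nat) (k k' : 'I_n.+1) : monotone cl ->
  sw cl k k' -> k <= k'.
Proof.
move=> mono /orP[/andP[hk le_k]|/andP[]//].
case: (ltngtP (cl k) (cl k')) le_k => // [/(mono_lt mono)/ltnW //|e _].
by apply: hd_le hk _.
Qed.

Lemma sw_perms1 n (cl : 'I_n.+1 -> nat) : monotone cl -> 1%g \in sw_perms cl.
Proof. by move=> mono; apply/SigmaLP => k k'; rewrite !perm1; apply: sw_le. Qed.

Lemma cols_perm_nw n (cl : 'I_n.+1 -> nat) : cols_perm cl \in nw_perms cl.
Proof.
apply/SigmaLP => k k' le_kk'; rewrite leqNgt cols_perm_lt.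
move: le_kk'; rewrite /nw /lt_cols; lia.
Qed.

Lemma rows_down_nw n (cl : 'I_n.+1 -> nat) : monotone cl ->
  rows_down cl \in nw_perms cl.
Proof.
move=> mono; apply/SigmaLP => k k' le_kk'; rewrite leqNgt rows_down_lt.
move: le_kk'; rewrite /nw /lt_rows_down /lt_cols.
have := @mono_lt _ cl k k' mono; have := @mono_lt _ cl k' k mono.
have hd_eq : k = k' :> nat -> hd cl k = hd cl k' by move/val_inj ->.
have := @hd_le _ cl k k'; have := @hd_le _ cl k' k; move: hd_eq.
by case: (hd cl k); case: (hd cl k') => //=; lia.
Qed.

Lemma rows_up_sw n (cl : 'I_n.+1 -> nat) : monotone cl -> rows_up cl \in sw_perms cl.
Proof.
move=> mono; apply/SigmaLP => k k' le_kk'; rewrite leqNgt rows_up_lt.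
move: le_kk'; rewrite /sw /lt_rows_up /lt_cols.
have := @mono_lt _ cl k k' mono; have := @mono_lt _ cl k' k mono.
have hd_eq : k = k' :> nat -> hd cl k = hd cl k' by move/val_inj ->.
have := @hd_le _ cl k k'; have := @hd_le _ cl k' k; move: hd_eq.
by case: (hd cl k); case: (hd cl k') => //=; lia.
Qed.

Lemma SigmaL_lt n (P : rel 'I_n.+1) (s : 'S_n.+1) (i j : 'I_n.+1) :
  s \in SigmaL P -> P i j -> i != j -> s i < s j.
Proof.
move=> /SigmaLP/(_ i j) sP /sP le_ij neq_ij; rewrite ltn_neqAle le_ij andbT.
by apply: contra_neq neq_ij => /val_inj/perm_inj.
Qed.

Lemma leL_mulP n (F U V : 'S_n.+1) :
  reflect (forall k k', F k < F k' -> U k' < U k -> V k' < V k)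
          (leL (F^-1 * U) (F^-1 * V))%g.
Proof.
rewrite leLP; apply: (iffP idP) => [sub_UV k k' lt_F lt_U | UV].
  have := Inv_sub_lt sub_UV lt_F; rewrite !permM !permK; exact.
apply/subsetP => -[x y]; rewrite !inE /= !permM => /andP[lt_xy lt_U].
by rewrite lt_xy UV // !permKV.
Qed.

Lemma leL_fiberP n (cl : 'I_n.+1 -> nat) (F U V : 'S_n.+1) : monotone cl ->
  F \in nw_perms cl -> U \in sw_perms cl -> V \in sw_perms cl ->
  reflect (forall k k', nw cl k k' -> U k' < U k -> V k' < V k)
          (leL (F^-1 * U) (F^-1 * V))%g.
Proof.
move=> mono nwF swU swV; apply: (iffP (leL_mulP F U V)) => UV k k' lt_F lt_U.
  apply: (UV _ _ _ lt_U); apply: SigmaL_lt nwF lt_F _.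
  by apply: contraTneq lt_U => ->; rewrite ltnn.
have neq_kk' : k' != k by apply: contraTneq lt_U => ->; rewrite ltnn.
have [sw1|nsw1] := boolP (sw cl k k').
  by move/SigmaLP: swU => /(_ _ _ sw1); rewrite leqNgt lt_U.
have [sw2|nsw2] := boolP (sw cl k' k); first exact: SigmaL_lt swV sw2 _.
have /orP[nw1|nw2] := nw_total mono nsw1 nsw2; first exact: UV nw1 lt_U.
by have := SigmaL_lt nwF nw2 neq_kk'; case: ltngtP lt_F.
Qed.

Lemma DesL_fiber n (cl : 'I_n.+1 -> nat) (F G U : 'S_n.+1) : monotone cl ->
  F \in nw_perms cl -> G \in nw_perms cl -> U \in sw_perms cl ->
  DesL (F^-1 * U)%g = DesL (G^-1 * U)%g.
Proof.
move=> mono nwF nwG swU; apply/setP => i.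
have swap H k k' : H \in nw_perms cl -> nw cl k k' || nw cl k' k -> k != k' ->
    (H k' < H k) = nw cl k' k.
  move=> nwH nw_kk' neq_kk'; apply/idP/idP => [|nw2].
    case/orP: nw_kk' => // nw1.
    by have := SigmaL_lt nwH nw1 neq_kk'; case: ltngtP.
  by apply: SigmaL_lt nwH nw2 _; rewrite eq_sym.
have desE H : (i \in DesL (H^-1 * U)%g) = (H (pos_hi U i) < H (pos_lo U i)).
  by apply: DesL_lt; rewrite permM permK ?perm_pos_lo ?perm_pos_hi.
rewrite !desE; set k := pos_lo U i; set k' := pos_hi U i.
have Uk : U k = i :> nat by rewrite perm_pos_lo.
have Uk' : U k' = i.+1 :> nat by rewrite perm_pos_hi.
have neq_kk' : k != k' := pos_neq U i.
suff nw_kk' : nw cl k k' || nw cl k' k by rewrite !swap.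
have [sw2|nsw2] := boolP (sw cl k' k).
  by move/SigmaLP: swU => /(_ _ _ sw2); rewrite Uk Uk' ltnn.
have [sw1|nsw1] := boolP (sw cl k k'); last exact: nw_total.
have [hd_k' | nhd_k'] := boolP (hd cl k').
  by move: sw1 nsw2; rewrite /sw /nw hd_k' implybT; lia.
have [eq_cl | neq_cl] := eqVneq (cl k) (cl k').
  by have := sw_le mono sw1; rewrite /nw eq_cl; lia.
have /andP[hd_k le_k] : hd cl k && (cl k <= cl k').
  by move: sw1; rewrite /sw (negbTE neq_cl) orbF.
have [h hd_h eq_h] := hd_ex cl k'.
have lt_kh : U k < U h.
  apply: SigmaL_lt swU _ _; first by rewrite /sw hd_k eq_h le_k.
  by apply: contra_neq neq_cl => ->.
have : U h < U k'.
  apply: SigmaL_lt swU _ _; first by rewrite /sw hd_h eq_h leqnn.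
  by apply: contraNneq nhd_k' => <-.
by rewrite Uk'; lia.
Qed.

Lemma in_fiber n (cl : 'I_n.+1 -> nat) (F s : 'S_n.+1) :
  (s \in fiber cl F) = ((F * s)%g \in sw_perms cl).
Proof. by rewrite inE. Qed.

Lemma fiber_interval n (cl : 'I_n.+1 -> nat) (F : 'S_n.+1) : monotone cl ->
  F \in nw_perms cl ->
  fiber cl F = intervalL F^-1%g (F^-1 * rows_up cl)%g.
Proof.
move=> mono nwF; apply/setP => s; rewrite in_fiber in_intervalL.
rewrite -[in RHS](mulKg F s); set U := (F * s)%g.
have nwP k k' : nw cl k k' -> U k' < U k -> F k < F k'.
  move=> nw_kk' lt_U; apply: SigmaL_lt nwF nw_kk' _.
  by apply: contraTneq lt_U => ->; rewrite ltnn.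
have sw1 := sw_perms1 mono; have swm := rows_up_sw mono.
apply/idP/andP => [swU | [le1 le2]].
  rewrite -[X in leL X]mulg1; split.
    apply/(leL_fiberP mono nwF sw1 swU) => k k'; rewrite !perm1 /nw => nw_kk' lt_kk'.
    have := mono_lt mono (k' := k'); move/(_ k) => lt_cl.
    by apply: SigmaL_lt swU _ _; rewrite ?neq_ltn ?lt_kk' // /sw; lia.
  apply/(leL_fiberP mono nwF swU swm) => k k' nw_kk' lt_U.
  have nsw : ~~ sw cl k k'.
    by apply: contraTN lt_U; rewrite -leqNgt => /((SigmaLP _ _ swU)).
  have neq_kk' : k != k' :> nat by apply: contraTneq lt_U => /val_inj ->; rewrite ltnn.
  rewrite rows_up_lt; move: nw_kk' nsw; rewrite /nw /sw /lt_rows_up /lt_cols.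
  by have := @hd_le _ cl k k'; case: (hd cl k); case: (hd cl k') => //=; lia.
apply/SigmaLP => k k' sw_kk'.
have [-> // | neq_kk'] := eqVneq k k'.
have lt_kk' : k < k' by rewrite ltn_neqAle neq_kk' (sw_le mono).
have neq_F : F k != F k' :> nat by apply: contra_neq neq_kk' => /val_inj/perm_inj.
rewrite -[X in leL X]mulg1 in le1.
case: (ltngtP (F k) (F k')) neq_F => // lt_F _.
  rewrite leqNgt; apply/negP => /((leL_mulP F U (rows_up cl)) le2 _ _ lt_F).
  by have := SigmaL_lt swm sw_kk' neq_kk'; case: ltngtP.
by rewrite ltnW // ((leL_mulP F 1 U) le1) // !perm1.
Qed.

(** * The descent class of a fiber *)

Lemma fiber_min n (cl : 'I_n.+1 -> nat) (F : 'S_n.+1) : monotone cl ->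
  F^-1%g \in fiber cl F.
Proof. by move=> mono; rewrite in_fiber mulgV sw_perms1. Qed.

Lemma fiber_max n (cl : 'I_n.+1 -> nat) (F : 'S_n.+1) : monotone cl ->
  (F^-1 * rows_up cl)%g \in fiber cl F.
Proof. by move=> mono; rewrite in_fiber mulKVg rows_up_sw. Qed.

Lemma leL_fiber n (cl : 'I_n.+1 -> nat) (F : 'S_n.+1) : monotone cl ->
  F \in nw_perms cl -> leL F^-1%g (F^-1 * rows_up cl)%g.
Proof.
move=> mono nwF; have := fiber_max F mono.
by rewrite fiber_interval // in_intervalL => /andP[].
Qed.

Lemma fiber_is_interval n (cl : 'I_n.+1 -> nat) (F : 'S_n.+1) : monotone cl ->
  F \in nw_perms cl -> is_intervalL (fiber cl F).
Proof.
move=> mono nwF; apply/existsP; exists F^-1%g; apply/existsP.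
by exists (F^-1 * rows_up cl)%g; rewrite leL_fiber //= fiber_interval.
Qed.

Lemma fiber_simD n (cl : 'I_n.+1 -> nat) (F G : 'S_n.+1) : monotone cl ->
  F \in nw_perms cl -> G \in nw_perms cl -> simD (fiber cl F) (fiber cl G).
Proof.
move=> mono nwF nwG; apply/existsP; exists [ffun s => (G^-1 * (F * s))%g].
apply/andP; split; last first.
  apply/forall_inP => s; rewrite in_fiber ffunE => swU; apply/eqP.
  by rewrite (DesL_fiber mono nwG nwF swU) mulKg.
apply/poset_isoP; split=> [s t _ _||s t].
- by rewrite !ffunE => /mulgI/mulgI.
- apply/setP => t; rewrite in_fiber; apply/imsetP/idP => [[s]|swU].
    by rewrite in_fiber ffunE => swU ->; rewrite mulKVg.
  by exists (F^-1 * (G * t))%g; rewrite ?in_fiber ?ffunE ?mulKVg ?mulKg.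
rewrite !in_fiber !ffunE => swU swV.
rewrite -[in RHS](mulKg F s) -[in RHS](mulKg F t).
by apply/(leL_fiberP mono nwG swU swV)/(leL_fiberP mono nwF swU swV).
Qed.

(* Descents for [U = 1] compare vertical neighbours; those for [U = rows_up cl]
   compare consecutive bottom boxes and consecutive other boxes. *)
Lemma nw_perms_DesL n (cl : 'I_n.+1 -> nat) (F F0 : 'S_n.+1) : monotone cl ->
  F0 \in nw_perms cl -> DesL F^-1%g = DesL F0^-1%g ->
  DesL (F^-1 * rows_up cl)%g = DesL (F0^-1 * rows_up cl)%g ->
  F \in nw_perms cl.
Proof.
move=> mono nwF0 des1 desm; set m := rows_up cl in desm.
have m_lt x y : (m x < m y) = lt_rows_up cl x y := rows_up_lt cl x y.
have step1 k : cl (inord k) = cl (inord k.+1 : 'I_n.+1) -> k < n ->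
    F (inord k.+1) < F (inord k).
  move=> eq_cl lt_kn; pose i := Ordinal lt_kn.
  have desE H : (i \in DesL H^-1%g) = (H (inord k.+1) < H (inord k)).
    by apply: DesL_lt; rewrite permK inordK //= ltnW.
  rewrite -desE des1 desE; apply: SigmaL_lt nwF0 _ _.
    by rewrite /nw eq_cl eqxx !inordK ?leqnSn ?orbT // ltnW.
  by rewrite -val_eqE /= !inordK ?gtn_eqF // ltnW.
have stepm p : p < n ->
    (F ((m^-1)%g (inord p.+1)) < F ((m^-1)%g (inord p))) =
    (F0 ((m^-1)%g (inord p.+1)) < F0 ((m^-1)%g (inord p))).
  move=> lt_pn; pose i := Ordinal lt_pn.
  have desE H : (i \in DesL (H^-1 * m)%g) =
      (H ((m^-1)%g (inord p.+1)) < H ((m^-1)%g (inord p))).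
    by apply: DesL_lt; rewrite permM permK permKV inordK //= ltnW.
  by rewrite -desE desm desE.
have lt_col (k k' : 'I_n.+1) : cl k = cl k' -> k' < k -> F k < F k'.
  move=> eq_cl lt_kk'.
  have := @chain_rel _ (fun a b => b < a) (fun j => F (inord j) : nat) k' k.
  rewrite /= !inord_val; apply=> // [b a c lt_ba lt_cb|j le_j lt_j].
    exact: ltn_trans lt_cb lt_ba.
  have lt_jn : j < n by have := ltn_ord k; lia.
  apply: step1 => //; have lt_jn' := ltnW lt_jn.
  have := mono k' (inord j); have := mono (inord j) (inord j.+1).
  have := mono (inord j.+1) k; rewrite !inordK ?ltnS // => h1 h2 h3.
  by apply/eqP; rewrite eqn_leq h2 //= (leq_trans (h1 lt_j)) // eq_cl h3.
have m_same (k k' : 'I_n.+1) (j : 'I_n.+1) : m k < m k' -> hd cl k = hd cl k' ->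
    m k <= m j -> m j <= m k' -> hd cl j = hd cl k.
  move=> lt_m eq_hd; rewrite leqNgt m_lt => lt_1; rewrite leqNgt m_lt => lt_2.
  move: lt_1 lt_2; rewrite /lt_rows_up -eq_hd.
  by case: (hd cl j); case: (hd cl k).
have chain_m (k k' : 'I_n.+1) : m k < m k' -> hd cl k = hd cl k' ->
    if hd cl k then F k < F k' else F k' < F k.
  move=> lt_m eq_hd.
  have := @chain_rel _ (if hd cl k then ltn : rel nat else fun a b => b < a)
    (fun j => F ((m^-1)%g (inord j)) : nat) (m k) (m k').
  rewrite !inord_val !permK => chain.
  suff : (if hd cl k then ltn : rel nat else fun a b => b < a) (F k) (F k').
    by case: (hd cl k).
  apply: chain => //.
    case: (hd cl k) => b a c; first exact: ltn_trans.
    by move=> lt_ba lt_cb; apply: ltn_trans lt_cb lt_ba.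
  move=> p le_p lt_p; have lt_pn : p < n by have := ltn_ord (m k'); lia.
  have := stepm p lt_pn.
  set x := (m^-1)%g (inord p); set y := (m^-1)%g (inord p.+1) => /= st.
  have mx : m x = p :> nat by rewrite permKV inordK // ltnW.
  have my : m y = p.+1 :> nat by rewrite permKV inordK.
  have lt_xy : m x < m y by rewrite mx my.
  have neq_xy : F x != F y :> nat.
    by apply: contraTneq lt_xy => /val_inj/perm_inj ->; rewrite ltnn.
  have hx : hd cl x = hd cl k by apply: m_same lt_m eq_hd _ _; rewrite mx // ltnW.
  have hy : hd cl y = hd cl k by apply: m_same lt_m eq_hd _ _; rewrite my // ltnW.
  move: lt_xy; rewrite m_lt /lt_rows_up hx hy eqxx.
  case: (hd cl k) hx hy => hx hy lt_xy /=.
    rewrite ltn_neqAle neq_xy leqNgt st -leqNgt.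
    move/SigmaLP: nwF0; apply; rewrite /nw hx hy /=.
    have := mono x y (ltnW lt_xy); rewrite leq_eqVlt => /predU1P[e|->//].
    by rewrite e eqxx (hd_le hy e) orbT.
  rewrite st; apply: SigmaL_lt nwF0 _ _; last by apply: contra_neq neq_xy => ->.
  by move: lt_xy; rewrite /lt_cols /nw hx hy /=; lia.
have same_hd k k' : nw cl k k' -> hd cl k = hd cl k' -> F k <= F k'.
  move=> nw_kk' eq_hd; have [-> // | neq_kk'] := eqVneq k k'.
  rewrite ltnW //; have neq_val : k != k' :> nat by [].
  move: nw_kk'; rewrite /nw => /orP[/andP[lt_cl _] | /andP[/eqP eq_cl le_kk']]; last first.
    by apply: lt_col => //; lia.
  have lt_kk' := mono_lt mono lt_cl.
  case hk : (hd cl k).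
    have := chain_m k k'; rewrite hk; apply=> //.
      by rewrite m_lt /lt_rows_up -eq_hd hk.
    by rewrite -eq_hd.
  have := chain_m k' k; rewrite -eq_hd hk; apply=> //.
  by rewrite m_lt /lt_rows_up -eq_hd hk /= /lt_cols lt_cl.
apply/SigmaLP => k k' nw_kk'.
have [/same_hd|neq_hd] := eqVneq (hd cl k) (hd cl k'); first exact.
move: nw_kk'; rewrite /nw => /orP[/andP[lt_cl imp_hd] | /andP[/eqP eq_cl le_kk']]; last first.
  have [-> // | neq_kk'] := eqVneq k k'.
  by rewrite ltnW // lt_col // ltn_neqAle eq_sym neq_kk'.
have [nhk hk'] : ~~ hd cl k /\ hd cl k'.
  by move: imp_hd neq_hd; case: (hd cl k); case: (hd cl k').
have [h hd_h eq_h] := hd_ex cl k.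
apply: (@leq_trans (F h)).
  rewrite ltnW // lt_col // ltn_neqAle (hd_le hd_h) // andbT.
  by apply: contraNneq nhk => /val_inj <-.
apply: same_hd; last by rewrite hd_h hk'.
by rewrite /nw eq_h lt_cl hk' implybT.
Qed.

Lemma classD_fiber n (cl : 'I_n.+1 -> nat) (F0 : 'S_n.+1) : monotone cl ->
  F0 \in nw_perms cl ->
  classD (fiber cl F0) = [set fiber cl F | F in nw_perms cl].
Proof.
move=> mono nwF0; apply/setP => J; rewrite inE; apply/andP/imsetP; last first.
  by case=> F nwF ->; rewrite fiber_is_interval ?fiber_simD.
case=> /existsP[s /existsP[r /andP[le_sr /eqP->]]] /existsP[f /andP[f_iso f_des]].
have f_desE : {in fiber cl F0, forall g, DesL (f g) = DesL g}.
  by move=> g Ig; move/forall_inP/(_ g Ig)/eqP: f_des.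
have := f_desE; have := f_iso; rewrite fiber_interval // => f_iso' f_des'.
have := poset_iso_translate (leL_fiber mono nwF0) f_iso' f_des'.
rewrite -fiber_interval // invgK => f_tr.
pose F := (f F0^-1%g)^-1%g; exists F; last first.
  have /poset_isoP[_ <- _] := f_iso; apply/setP => t; rewrite in_fiber.
  apply/imsetP/idP => [[g Ig ->]|swU].
    by rewrite f_tr // /F -mulgA mulKg -in_fiber.
  exists (F0^-1 * (F * t))%g; first by rewrite in_fiber mulKVg.
  by rewrite f_tr ?in_fiber ?mulKVg // /F -!mulgA !(mulKVg, mulKg).
have f_tr' U : U \in sw_perms cl -> f (F0^-1 * U)%g = (F^-1 * U)%g.
  by move=> swU; rewrite f_tr ?in_fiber ?mulKVg // /F invgK -mulgA mulKVg.
apply: nw_perms_DesL nwF0 _ _ => //.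
  by rewrite /F invgK f_desE // fiber_min.
by rewrite -f_tr' ?rows_up_sw // f_desE // fiber_max.
Qed.

Lemma le_interval_fiber n (cl : 'I_n.+1 -> nat) (F G : 'S_n.+1) : monotone cl ->
  F \in nw_perms cl -> G \in nw_perms cl ->
  le_interval (fiber cl F) (fiber cl G) = leL F G.
Proof.
move=> mono nwF nwG; apply/idP/idP; last first.
  move=> le_FG; apply/existsP; exists F^-1%g.
  apply/existsP; exists (F^-1 * rows_up cl)%g; apply/existsP; exists G^-1%g.
  apply/existsP; exists (G^-1 * rows_up cl)%g.
  by rewrite !leL_fiber // !fiber_interval // !eqxx leRE !invgK.
case/existsP=> s /existsP[r /existsP[s' /existsP[r' /and5P[le_sr /eqP eqF le_sr' /eqP eqG]]]].
rewrite leRE; suff minE H u v : leL u v -> H \in nw_perms cl ->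
    fiber cl H = intervalL u v -> u^-1%g = H.
  by rewrite (minE F s r) // (minE G s' r').
move=> le_uv nwH eqH; rewrite -[H]invgK; congr _^-1%g; apply: leL_anti.
have := fiber_min H mono; rewrite eqH in_intervalL => /andP[-> _] /=.
have : u \in intervalL u v by rewrite in_intervalL leL_refl.
by rewrite -eqH fiber_interval // in_intervalL => /andP[].
Qed.

Lemma fiber_inj n (cl : 'I_n.+1 -> nat) : monotone cl ->
  {in nw_perms cl &, injective (fiber cl)}.
Proof.
move=> mono F G nwF nwG eq_FG; apply: leL_anti.
rewrite -(le_interval_fiber mono nwF nwG) -(le_interval_fiber mono nwG nwF).
by rewrite eq_FG le_interval_fiber // leL_refl.
Qed.

Lemma cols_perm_min n (cl : 'I_n.+1 -> nat) (F : 'S_n.+1) : monotone cl ->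
  F \in nw_perms cl -> leL (cols_perm cl) F.
Proof.
move=> mono nwF; rewrite leLP; apply/subsetP => -[k k']; rewrite !inE /=.
case/andP => lt_kk'; rewrite cols_perm_lt lt_kk' /lt_cols => lt_c.
apply: SigmaL_lt nwF _ _; first by have := mono _ _ (ltnW lt_kk'); rewrite /nw; lia.
by apply: contraTneq lt_kk' => ->; rewrite ltnn.
Qed.

Lemma rows_down_max n (cl : 'I_n.+1 -> nat) (F : 'S_n.+1) : monotone cl ->
  F \in nw_perms cl -> leL F (rows_down cl).
Proof.
move=> mono nwF; rewrite leLP; apply/subsetP => -[k k']; rewrite !inE /=.
case/andP => lt_kk' lt_F; rewrite lt_kk' rows_down_lt.
have nnw : ~~ nw cl k k' by apply: contraTN lt_F => /(SigmaLP _ _ nwF); rewrite -leqNgt.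
have := mono _ _ (ltnW lt_kk'); have := @hd_le _ cl k' k.
move: nnw; rewrite /lt_rows_down /lt_cols /nw.
by case: (hd cl k); case: (hd cl k') => //=; lia.
Qed.

(** * Columns of a composition *)

Definition col_of n (a : seq nat) (k : 'I_n.+1) : nat := reshape_index a k.

Definition off_of n (a : seq nat) (k : 'I_n.+1) : nat := reshape_offset a k.

Lemma col_off_leq n (a : seq nat) (k k' : 'I_n.+1) :
  (k <= k') = (col_of a k < col_of a k') ||
              (col_of a k == col_of a k') && (off_of a k <= off_of a k').
Proof. exact: reshape_leq. Qed.

Lemma col_of_monotone n (a : seq nat) : monotone (@col_of n a).
Proof. by move=> k k'; rewrite (col_off_leq a); lia. Qed.

Lemma col_off_bound n (a : seq nat) (k : 'I_n.+1) : is_composition n.+1 a ->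
  col_of a k < size a /\ off_of a k < nth 0 a (col_of a k).
Proof.
case/andP=> _ /eqP sum_a; have lt_k : k < sumn a by rewrite sum_a.
by split; [exact: reshape_indexP | exact: reshape_offsetP].
Qed.

Lemma comp_part_gt0 n (a : seq nat) (i : nat) : is_composition n.+1 a ->
  i < size a -> 0 < nth 0 a i.
Proof.
by case/andP=> a0 _ lt_i; rewrite lt0n; apply: contraNneq a0 => <-; rewrite mem_nth.
Qed.

Lemma cell_ex n (a : seq nat) (i j : nat) : is_composition n.+1 a ->
  j < nth 0 a i -> exists2 k : 'I_n.+1, col_of a k = i & off_of a k = j.
Proof.
case/andP=> _ /eqP sum_a lt_j; have := flatten_indexP lt_j; rewrite sum_a => lt_k.
by exists (Ordinal lt_k); rewrite /col_of /off_of /= ?flatten_indexKl ?flatten_indexKr.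
Qed.

Lemma col_off_inj n (a : seq nat) (k k' : 'I_n.+1) :
  col_of a k = col_of a k' -> off_of a k = off_of a k' -> k = k'.
Proof.
move=> eq_c eq_o; apply: val_inj; rewrite /= -(reshape_indexK a k).
by rewrite -(reshape_indexK a k') -!/(col_of a _) -!/(off_of a _) eq_c eq_o.
Qed.

Lemma hd_off n (a : seq nat) (k : 'I_n.+1) : is_composition n.+1 a ->
  hd (col_of a) k = (off_of a k == 0).
Proof.
move=> ha; have [lt_c lt_o] := col_off_bound k ha; apply/idP/eqP => [hd_k | off0].
  have [h ch oh] := cell_ex ha (comp_part_gt0 ha lt_c).
  have := hd_le hd_k ch; rewrite (col_off_leq a) ch oh ltnn eqxx /=.
  by rewrite leqn0 => /eqP.
apply/forallP => k'; apply/implyP => /eqP eq_c.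
by rewrite (col_off_leq a) eq_c eqxx off0 orbT.
Qed.

Lemma col_of_lt n (a : seq nat) (k : 'I_n.+1) (t : nat) : is_composition n.+1 a ->
  t <= size a -> (col_of a k < t) = (k < sumn (take t a)).
Proof.
move=> ha le_t; have [lt_c lt_o] := col_off_bound k ha.
have sum_mono i j : i <= j -> sumn (take i a) <= sumn (take j a).
  by move=> le_ij; rewrite -(subnKC le_ij) takeD sumn_cat leq_addr.
rewrite -(reshape_indexK a k) /flatten_index -/(col_of a k) -/(off_of a k).
apply/idP/idP => [lt_ct | ]; last first.
  by apply: contraTT; rewrite -!leqNgt => /sum_mono; lia.
apply: leq_trans (sum_mono _ _ lt_ct); rewrite (take_nth 0) // sumn_rcons.
by rewrite ltn_add2l.
Qed.

Lemma cols_perm_w0 n (a : seq nat) : is_composition n.+1 a ->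
  cols_perm (col_of a) = w0 (~: comp_set n a).
Proof.
move=> ha; apply: block_rev_inj (block_rev_w0 _); split.
  move=> i; rewrite inE => nSi; have lt_in := ltn_ord i.
  have lt_cs := (col_off_bound (inord i.+1 : 'I_n.+1) ha).1.
  have := @col_of_monotone n a (inord i) (inord i.+1).
  rewrite cols_perm_lt /lt_cols !inordK ?ltnS ?ltnSn ?andbT // 1?ltnW //.
  move=> /(_ isT); rewrite leq_eqVlt => /orP[/eqP->|lt_c]; first by rewrite eqxx leqnn ltnn.
  case/negP: nSi; rewrite inE; apply/mapP.
  exists (col_of a (inord i.+1 : 'I_n.+1)); first
    by rewrite mem_iota (leq_ltn_trans _ lt_c) //= add1n prednK // (leq_ltn_trans _ lt_cs).
  have i_lt := col_of_lt (inord i : 'I_n.+1) ha (ltnW lt_cs).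
  have i_ge := col_of_lt (inord i.+1 : 'I_n.+1) ha (ltnW lt_cs).
  have i_val : (inord i : 'I_n.+1) = i :> nat by rewrite inordK // ltnW.
  have i1_val : (inord i.+1 : 'I_n.+1) = i.+1 :> nat by rewrite inordK.
  rewrite lt_c i_val in i_lt; rewrite ltnn i1_val in i_ge.
  by apply/eqP; rewrite eqn_leq -i_lt leqNgt -i_ge.
move=> c x y; rewrite !inE negbK => /mapP[t]; rewrite mem_iota => t_bd e le_xc lt_cy.
rewrite cols_perm_lt /lt_cols; apply/orP; left.
have le_t : t <= size a by lia.
apply: (@leq_trans t); first by rewrite col_of_lt // -e.
by rewrite leqNgt col_of_lt // -e -leqNgt.
Qed.

Lemma card_hd n (a : seq nat) : is_composition n.+1 a ->
  #|[set k : 'I_n.+1 | hd (col_of a) k]| = size a.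
Proof.
move=> ha; rewrite -[RHS]card_ord.
have bd (k : 'I_n.+1) : col_of a k < size a := (col_off_bound k ha).1.
pose f (k : 'I_n.+1) : 'I_(size a) := Ordinal (bd k).
rewrite -(@card_in_imset _ _ f) => [|k k'].
  apply: eq_card => i; rewrite !inE; apply/imsetP.
  have [k ck ok] := cell_ex ha (comp_part_gt0 ha (ltn_ord i)).
  exists k; first by rewrite inE hd_off // ok.
  by apply: val_inj; rewrite /= ck.
rewrite !inE !hd_off // => /eqP ok /eqP ok' [] ck.
by apply: (col_off_inj ck); rewrite ok ok'.
Qed.

Lemma rows_down_hd n (a : seq nat) (k : 'I_n.+1) : is_composition n.+1 a ->
  hd (col_of a) k = (n.+1 - size a <= rows_down (col_of a) k).
Proof.
move=> ha; set A := [set k : 'I_n.+1 | ~~ hd (col_of a) k].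
have card_A : #|A| = n.+1 - size a.
  have := cardsC [set k : 'I_n.+1 | hd (col_of a) k]; rewrite card_hd // card_ord => e.
  apply/eqP; rewrite -(eqn_add2l (size a)) subnKC; last by rewrite -[X in _ <= X]e leq_addr.
  by apply/eqP; rewrite -[RHS]e; congr (_ + _); apply: eq_card => i; rewrite !inE.
rewrite -card_A -perm_rank; apply/idP/idP => [hk | ].
  apply/subset_leq_card/subsetP => i; rewrite !inE => nhi.
  by rewrite rows_down_lt /lt_rows_down (negbTE nhi) hk.
apply: contraTT => nhk; rewrite -ltnNge; apply: proper_card; apply/properP; split.
  apply/subsetP => i; rewrite !inE rows_down_lt /lt_rows_down (negbTE nhk).
  by case: (hd _ i).
by exists k; rewrite !inE ?ltnn.
Qed.

Lemma rows_down_w1 n (a : seq nat) : is_composition n.+1 a ->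
  ((rows_down (col_of a))^-1 * rows_up (col_of a))%g = w1 (initial_set n (n.+1 - size a)).
Proof.
move=> ha; rewrite /w1 /pmul; set u := w0 setT; set S := initial_set _ _.
have u_anti (x y : 'I_n.+1) : (u x < u y) = (y < x).
  have rev_u := block_rev_w0 (setT : {set 'I_n}).
  have u_lt (z t : 'I_n.+1) : z < t -> u t < u z.
    by move=> lt_zt; apply: block_rev_gt rev_u lt_zt _ => c _ _; rewrite inE.
  case: (ltngtP x y) => [/u_lt|/u_lt//|/val_inj->]; last by rewrite ltnn.
  by case: ltngtP.
apply: (canRL (mulgKV u)); rewrite w0V -/u.
apply: block_rev_inj (block_rev_w0 _); set d := rows_down _; set m := rows_up _.
have d_lt (x y : 'I_n.+1) : x < y -> lt_rows_down (col_of a) ((d^-1)%g x) ((d^-1)%g y).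
  by move=> lt_xy; rewrite -rows_down_lt !permKV.
have d_hd (x : 'I_n.+1) : hd (col_of a) ((d^-1)%g x) = (n.+1 - size a <= x).
  by rewrite rows_down_hd // permKV.
split=> [i | c x y]; rewrite inE ?negbK !inE => bd_i.
  have lt_in := ltn_ord i.
  have hi : hd (col_of a) ((d^-1)%g (inord i)) by rewrite d_hd inordK; lia.
  have hi' : hd (col_of a) ((d^-1)%g (inord i.+1)) by rewrite d_hd inordK; lia.
  have := d_lt (inord i) (inord i.+1); rewrite !inordK ?ltnSn //; last by lia.
  by rewrite !permM u_anti rows_up_lt /lt_rows_down /lt_rows_up hi hi'; apply.
move=> le_xc lt_cy; rewrite !permM u_anti rows_up_lt.
have nhx : ~~ hd (col_of a) ((d^-1)%g x) by rewrite d_hd; lia.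
have := d_lt x y (leq_ltn_trans le_xc lt_cy).
by rewrite /lt_rows_down /lt_rows_up (negbTE nhx); case: (hd _ _).
Qed.

(** * Reading words *)

Lemma perm_of_word_map n (s : 'S_n.+1) :
  perm_of_word [seq s p | p <- enum 'I_n.+1] = s.
Proof.
rewrite /perm_of_word; set g := [ffun i => _].
have -> : g = pval s.
  apply/ffunP => i; rewrite ffunE (nth_map ord0) ?size_enum_ord // nth_ord_enum.
  by rewrite pvalE.
exact: valKd.
Qed.

Lemma pairwise_seqE n (D : finType) (e : 'I_n.+1 -> D) (w : 'S_n.+1) (r : rel D)
    (s : seq D) :
  bijective e -> (forall k k', r (e k) (e k') -> w k <= w k') ->
  perm_eq s (enum D) -> pairwise r s ->
  s = [seq e ((w^-1)%g p) | p <- enum 'I_n.+1].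
Proof.
case=> g eK gK r_w s_enum r_s.
pose h b : 'I_n.+1 := w (g b).
have h_inj : injective h by move=> b c /perm_inj /(can_inj gK).
have hs : map h s = enum 'I_n.+1.
  apply: (inj_map val_inj); apply: (sorted_eq leq_trans anti_leq).
  - rewrite -map_comp sorted_pairwise; last exact: leq_trans.
    rewrite pairwise_map; apply: sub_pairwise r_s => b c /=.
    by rewrite -{1}[b]gK -{1}[c]gK => /r_w.
  - by rewrite val_enum_ord iota_sorted.
  apply: perm_map; apply: uniq_perm; rewrite ?enum_uniq //.
    by rewrite map_inj_uniq // (perm_uniq s_enum) enum_uniq.
  move=> p; rewrite mem_enum; apply/mapP; exists (e ((w^-1)%g p)).
    by rewrite (perm_mem s_enum) mem_enum.
  by rewrite /h eK permKV.
rewrite -hs -map_comp -[LHS]map_id; apply: eq_map => b /=.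
by rewrite /h permK gK.
Qed.

Lemma pairwise_filter_split (T : eqType) (p : pred T) (r r' : rel T) (s s' : seq T) :
  pairwise r s -> pairwise r' s' ->
  pairwise (fun b c => if p b == p c then (if p b then r b c else r' b c) else p b)
    ([seq x <- s | p x] ++ [seq x <- s' | ~~ p x]).
Proof.
move=> r_s r_s'; rewrite pairwise_cat; apply/and3P; split.
- apply/allrelP => b c; rewrite !mem_filter => /andP[pb _] /andP[npc _].
  by rewrite pb (negbTE npc).
- apply: (sub_in_pairwise (P := p)) (filter_all _ _) (pairwise_filter _ r_s).
  by move=> b c; rewrite unfold_in => pb; rewrite unfold_in => pc r_bc; rewrite pb pc.
apply: (sub_in_pairwise (P := predC p)) (filter_all _ _) (pairwise_filter _ r_s').
move=> b c; rewrite unfold_in /= => npb; rewrite unfold_in /= => npc r_bc.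
by rewrite (negbTE npb) (negbTE npc).
Qed.

Lemma perm_boxes (D : diagram) (le : rel box) : perm_eq (boxes D le) (enum {: D}).
Proof. exact: permEl (perm_sort _ _). Qed.

Lemma perm_filter_boxes (D : diagram) (p : pred D) (le le' : rel box) :
  perm_eq ([seq b <- boxes D le | p b] ++ [seq b <- boxes D le' | ~~ p b]) (enum {: D}).
Proof.
rewrite -(permPr (perm_boxes D le)) -(permPr (permEl (perm_filterC p _))).
rewrite perm_cat2l; apply: perm_filter.
by rewrite (permPl (perm_boxes D le')) perm_sym perm_boxes.
Qed.

Lemma pairwise_boxes (D : diagram) (le : rel box) : transitive le -> total le ->
  pairwise (fun b c : D => le (val b) (val c)) (boxes D le).
Proof.
move=> le_tr le_tot; rewrite -sorted_pairwise; first by apply: sort_sorted => b c.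
by move=> b c d; apply: le_tr.
Qed.

Lemma columns_TL_trans : transitive columns_TL.
Proof. by move=> [b1 b2] [c1 c2] [d1 d2]; rewrite /columns_TL /=; lia. Qed.

Lemma columns_TL_total : total columns_TL.
Proof. by move=> [b1 b2] [c1 c2]; rewrite /columns_TL /=; lia. Qed.

Lemma rows_RB_trans : transitive rows_RB.
Proof. by move=> [b1 b2] [c1 c2] [d1 d2]; rewrite /rows_RB /=; lia. Qed.

Lemma rows_RB_total : total rows_RB.
Proof. by move=> [b1 b2] [c1 c2]; rewrite /rows_RB /=; lia. Qed.

Lemma rows_LB_trans : transitive rows_LB.
Proof. by move=> [b1 b2] [c1 c2] [d1 d2]; rewrite /rows_LB /=; lia. Qed.

Lemma rows_LB_total : total rows_LB.
Proof. by move=> [b1 b2] [c1 c2]; rewrite /rows_LB /=; lia. Qed.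

Lemma rows_LT_trans : transitive rows_LT.
Proof. by move=> [b1 b2] [c1 c2] [d1 d2]; rewrite /rows_LT /=; lia. Qed.

Lemma rows_LT_total : total rows_LT.
Proof. by move=> [b1 b2] [c1 c2]; rewrite /rows_LT /=; lia. Qed.

Lemma diagram_enum n (D : diagram) (c : 'I_n.+1 -> box) :
  injective c -> (forall b, (b \in D) = [exists k, c k == b]) ->
  exists e : 'I_n.+1 -> D, bijective e /\ forall k, val (e k) = c k.
Proof.
move=> c_inj D_c; have Dc k : (c k \in D)%fset.
  by rewrite D_c; apply/existsP; exists k.
pose e k : D := [` Dc k]%fset; exists e; split=> //.
have ex_k (b : D) : exists k, c k == val b by apply/existsP; rewrite -D_c (valP b).
exists (fun b => xchoose (ex_k b)) => [k | b].
  by apply: c_inj; rewrite (eqP (xchooseP (ex_k (e k)))).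
by apply: val_inj; rewrite /= (eqP (xchooseP (ex_k b))).
Qed.

Lemma standard_perm n (D : diagram) (e : 'I_n.+1 -> D) (T : filling n D) :
  bijective e -> standard T -> exists F : 'S_n.+1, forall k, T (e k) = F k.
Proof.
move=> e_bij /andP[/injectiveP T_inj _].
have Te_inj : injective (fun k => T (e k)) by move=> k k' /T_inj /(bij_inj e_bij).
by exists (perm Te_inj) => k; rewrite permE.
Qed.

Lemma perm_filling n (D : diagram) (e : 'I_n.+1 -> D) (F : 'S_n.+1) :
  bijective e -> exists2 T : filling n D, standard T & forall k, T (e k) = F k.
Proof.
case=> g eK gK; exists [ffun b => F (g b)] => [|k]; last by rewrite ffunE eK.
apply/andP; split.
  by apply/injectiveP => b c; rewrite !ffunE => /perm_inj /(can_inj gK).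
apply/forallP => p; apply/codomP; exists (e ((F^-1)%g p)).
by rewrite ffunE eK permKV.
Qed.

Lemma filling_eq n (D : diagram) (e : 'I_n.+1 -> D) (T U : filling n D) :
  bijective e -> (forall k, T (e k) = U (e k)) -> T = U.
Proof. by case=> g eK gK TU; apply/ffunP => b; rewrite -(gK b). Qed.

Lemma word_perm n (D : diagram) (e : 'I_n.+1 -> D) (w F : 'S_n.+1)
    (T : filling n D) (s : seq D) :
  (forall k, T (e k) = F k) -> s = [seq e ((w^-1)%g p) | p <- enum 'I_n.+1] ->
  perm_of_word [seq T b | b <- s] = (w^-1 * F)%g.
Proof.
move=> TF ->; rewrite -map_comp -[RHS]perm_of_word_map; congr perm_of_word.
by apply: eq_map => p; rewrite /= TF permM.
Qed.

Lemma fill_along_perm n (D : diagram) (e : 'I_n.+1 -> D) (w : 'S_n.+1) (s : seq D) :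
  bijective e -> s = [seq e ((w^-1)%g p) | p <- enum 'I_n.+1] ->
  forall k, fill_along n s (e k) = w k.
Proof.
move=> e_bij -> k; rewrite ffunE -{1}[k](permK w).
rewrite (index_map (f := fun p => e ((w^-1)%g p))) ?index_enum_ord ?inord_val //.
by move=> p q /(bij_inj e_bij) /perm_inj.
Qed.

(** * The diagram of a composition and its reflection *)

Definition tcd_box n (a : seq nat) (k : 'I_n.+1) : box :=
  ((off_of a k).+1, (col_of a k).+1).

Lemma tcd_enum n (a : seq nat) : is_composition n.+1 a ->
  exists e : 'I_n.+1 -> tcd a, bijective e /\ forall k, val (e k) = tcd_box a k.
Proof.
move=> ha; apply: diagram_enum => [k k' [eq_o eq_c] | [x y]].
  exact: col_off_inj eq_c eq_o.
rewrite !inE /=; apply/allpairsPdep/existsP => [[i [j]] | [k /eqP[<- <-]]].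
  rewrite !mem_iota /part => -[bd_i bd_j [-> ->]].
  have lt_j : j.-1 < nth 0 a i.-1 by lia.
  have [k ck ok] := cell_ex ha lt_j; exists k.
  by rewrite /tcd_box ck ok !prednK //; lia.
have [lt_c lt_o] := col_off_bound k ha.
exists (col_of a k).+1, (off_of a k).+1; rewrite !mem_iota /part /=; split=> //; lia.
Qed.

Definition diag_row n (a : seq nat) (k : 'I_n.+1) : nat :=
  if hd (col_of a) k then 1 else (off_of a k).+1 + shift_V a (col_of a k).+1.

Definition diag_box n (a : seq nat) (k : 'I_n.+1) : box :=
  ((col_of a k).+1, diag_row a k).

Lemma shift_V_lt (a : seq nat) (i j : nat) : i < j -> j <= size a ->
  part a j - 1 + shift_V a j <= shift_V a i.
Proof.
move=> lt_ij le_j; rewrite /shift_V (@big_cat_nat _ _ _ j i.+1) //=; last by lia.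
by rewrite [X in _ <= _ + X]big_ltn ?ltnS // leq_addl.
Qed.

Lemma diag_row_lt n (a : seq nat) (k k' : 'I_n.+1) : is_composition n.+1 a ->
  col_of a k < col_of a k' ->
  (diag_row a k' <= diag_row a k) = (hd (col_of a) k ==> hd (col_of a) k') /\
  (diag_row a k <= diag_row a k') = hd (col_of a) k.
Proof.
move=> ha lt_c; have [lt_ck' lt_ok'] := col_off_bound k' ha.
have : (col_of a k).+1 < (col_of a k').+1 by [].
move=> /shift_V_lt /(_ lt_ck'); rewrite /part /= => le_sh.
rewrite /diag_row !hd_off //.
by case: (eqVneq (off_of a k) 0); case: (eqVneq (off_of a k') 0) => /=; lia.
Qed.

Lemma diag_row_same n (a : seq nat) (k k' : 'I_n.+1) : is_composition n.+1 a ->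
  col_of a k = col_of a k' -> (diag_row a k <= diag_row a k') = (k <= k').
Proof.
move=> ha eq_c; rewrite (col_off_leq a) eq_c ltnn eqxx /= /diag_row !hd_off // eq_c.
by case: (eqVneq (off_of a k) 0); case: (eqVneq (off_of a k') 0) => /=; lia.
Qed.

Lemma box_le_diag n (a : seq nat) (k k' : 'I_n.+1) : is_composition n.+1 a ->
  box_le (diag_box a k) (diag_box a k') = sw (col_of a) k k'.
Proof.
move=> ha; rewrite /box_le /sw /= ltnS.
case: (ltngtP (col_of a k) (col_of a k')) => [lt_c|lt_c|eq_c] /=.
- by rewrite (diag_row_lt ha lt_c).2 andbT orbF.
- by rewrite andbF.
rewrite diag_row_same // andbT; case: (boolP (hd _ k)) => //= hk.
exact: hd_le hk (esym eq_c).
Qed.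

Lemma nw_diag n (a : seq nat) (k k' : 'I_n.+1) : is_composition n.+1 a ->
  (col_of a k <= col_of a k') && (diag_row a k' <= diag_row a k) =
  nw (col_of a) k k'.
Proof.
move=> ha; rewrite /nw; case: (ltngtP (col_of a k) (col_of a k')) => // [lt_c|eq_c] /=.
  by rewrite (diag_row_lt ha lt_c).1 orbF.
by rewrite diag_row_same.
Qed.

Lemma diag_V_mem n (a : seq nat) (b : box) : is_composition n.+1 a ->
  (b \in diag_V a) = [exists k : 'I_n.+1, diag_box a k == b].
Proof.
move=> ha; rewrite !inE; apply/idP/existsP =>
  [/orP[/mapP[i] | /allpairsPdep[i [j]]] | [k /eqP <-]].
- rewrite mem_iota => bd_i ->.
  have lt_0 : 0 < nth 0 a i.-1.
    by apply: (comp_part_gt0 ha); lia.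
  have [k ck ok] := cell_ex ha lt_0; exists k.
  by rewrite /diag_box /diag_row hd_off // ck ok prednK //; lia.
- rewrite !mem_iota /part => -[bd_i bd_j ->].
  have lt_j : j.-1 < nth 0 a i.-1 by lia.
  have [k ck ok] := cell_ex ha lt_j; exists k.
  rewrite /diag_box /diag_row hd_off // ck ok prednK; last by lia.
  by rewrite ifN ?prednK //; lia.
have [lt_c lt_o] := col_off_bound k ha; rewrite /diag_box /diag_row hd_off //.
have [o0 | o_gt0] := posnP (off_of a k); apply/orP; [left | right].
  by apply/mapP; exists (col_of a k).+1; rewrite // mem_iota; lia.
apply/allpairsPdep; exists (col_of a k).+1, (off_of a k).+1.
by rewrite !mem_iota /part /=; split=> //; lia.
Qed.

Definition flip_diag_box n (a : seq nat) (k : 'I_n.+1) : box :=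
  flip_box (height (diag_V a)) (diag_box a k).

Lemma le_height (D : diagram) (b : box) : b \in D -> b.2 <= height D.
Proof. by move=> Db; rewrite /height (big_rem _ Db) /= leq_maxl. Qed.

Lemma diag_row_le n (a : seq nat) (k : 'I_n.+1) : is_composition n.+1 a ->
  diag_row a k <= height (diag_V a).
Proof.
move=> ha; apply: (@le_height _ (diag_box a k)); rewrite (diag_V_mem _ ha).
by apply/existsP; exists k.
Qed.

Lemma flip_diag_enum n (a : seq nat) : is_composition n.+1 a ->
  exists e : 'I_n.+1 -> flip_diag (diag_V a),
    bijective e /\ forall k, val (e k) = flip_diag_box a k.
Proof.
move=> ha; apply: diagram_enum => [k k' [eq_c eq_r] | b].
  have le_r := diag_row_le k ha; have le_r' := diag_row_le k' ha.
  have eq_row : diag_row a k = diag_row a k' by lia.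
  apply: val_inj; apply/eqP; rewrite eqn_leq -(diag_row_same ha eq_c).
  by rewrite -(diag_row_same ha (esym eq_c)) eq_row leqnn.
apply/imfsetP/existsP => /= [[c Dc ->] | [k /eqP <-]].
  by move: Dc; rewrite (diag_V_mem _ ha) => /existsP[k /eqP <-]; exists k.
exists (diag_box a k) => //; by rewrite (diag_V_mem _ ha); apply/existsP; exists k.
Qed.

Lemma box_le_flip_diag n (a : seq nat) (k k' : 'I_n.+1) : is_composition n.+1 a ->
  box_le (flip_diag_box a k) (flip_diag_box a k') = nw (col_of a) k k'.
Proof.
move=> ha; rewrite -nw_diag // /box_le /flip_diag_box /flip_box /= ltnS.
by have := diag_row_le k ha; have := diag_row_le k' ha; lia.
Qed.

Section FlipDiag.

Variables (n : nat) (a : seq nat).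
Local Notation D' := (flip_diag (diag_V a)).
Variable e : 'I_n.+1 -> D'.
Hypothesis ha : is_composition n.+1 a.
Hypothesis e_bij : bijective e.
Hypothesis eE : forall k, val (e k) = flip_diag_box a k.

Lemma w_TL_perm (T : filling n D') (F : 'S_n.+1) :
  (forall k, T (e k) = F k) -> w_TL T = F.
Proof.
move=> TF; rewrite /w_TL (@word_perm _ _ e 1%g F) ?invg1 ?mul1g //.
have := @pairwise_seqE _ _ e 1%g _ (boxes D' columns_TL) e_bij _
  (perm_boxes _ _) (pairwise_boxes _ columns_TL_trans columns_TL_total).
rewrite invg1; apply=> k k'; rewrite !eE !perm1 /columns_TL /=.
case/orP => [lt_c|/andP[/eqP[eq_c]]]; first
  exact: ltnW (mono_lt (@col_of_monotone _ a) lt_c).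
rewrite -(diag_row_same ha eq_c).
by have := diag_row_le k ha; have := diag_row_le k' ha; lia.
Qed.

Lemma ST_perm (T : filling n D') :
  T \in ST n D' <->
  exists2 F : 'S_n.+1, F \in nw_perms (col_of a) & forall k, T (e k) = F k.
Proof.
have [g eK gK] := e_bij; rewrite inE; split=> [/andP[stT /forallP T_le] | [F nwF TF]].
  have [F TF] := standard_perm e_bij stT; exists F => //.
  apply/SigmaLP => k k' nw_kk'; rewrite -!TF.
  by move/forallP: (T_le (e k)) => /(_ (e k')) /implyP; apply; rewrite !eE box_le_flip_diag.
apply/andP; split.
  have [U stU UF] := perm_filling F e_bij.
  suff -> : T = U by [].
  by apply: (filling_eq e_bij) => k; rewrite TF UF.
apply/forallP => b; apply/forallP => c; apply/implyP.
rewrite -(gK b) -(gK c) !eE box_le_flip_diag // !TF; exact: (SigmaLP _ _ nwF).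
Qed.

Lemma SigmaL_flip_fill (T : filling n D') (F : 'S_n.+1) :
  (forall k, T (e k) = F k) ->
  SigmaL (fill_poset (flip_fill T)) = fiber (col_of a) F.
Proof.
move=> TF; have [g eK gK] := e_bij.
have row_bd (k : 'I_n.+1) : diag_row a k <= height (diag_V a) := diag_row_le k ha.
have le_h (b : D') : (val b).2 <= height D' := le_height (valP b).
have sigma_le (k k' : 'I_n.+1) : box_le (flip_box (height D') (flip_diag_box a k))
    (flip_box (height D') (flip_diag_box a k')) = sw (col_of a) k k'.
  rewrite -box_le_diag // /box_le /flip_diag_box /flip_box /=.
  have := le_h (e k); have := le_h (e k'); rewrite !eE /flip_diag_box /flip_box /=.
  by have := row_bd k; have := row_bd k'; lia.
have unflip (c : flip_diag D') : exists2 k, flip_fill T c = F k &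
    val c = flip_box (height D') (flip_diag_box a k).
  exists (g [` flip_box_in c]%fset); first by rewrite ffunE -TF gK.
  rewrite -eE gK /=; case/imfsetP: (valP c) => -[x y] /= /le_height /= le_y ->.
  by rewrite /flip_box /=; congr (_, _); lia.
apply/setP => s; rewrite in_fiber; apply/SigmaLP/SigmaLP => s_le.
  move=> k k' sw_kk'; rewrite !permM; apply: s_le.
  have Dk i : (flip_box (height D') (val (e i)) \in flip_diag D')%fset.
    by apply/imfsetP; exists (val (e i)) => //=; apply: valP.
  apply/existsP; exists [` Dk k]%fset; apply/existsP; exists [` Dk k']%fset.
  have fillK i : flip_fill T [` Dk i]%fset = F i.
    rewrite ffunE -TF; congr (T _); apply: val_inj => /=.
    have := le_h (e i); rewrite /flip_box /=; case: (fsval (e i)) => x y /= le_y.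
    by congr (_, _); lia.
  by rewrite !fillK !eqxx /= !eE sigma_le.
move=> i j /existsP[b /existsP[c /and3P[/eqP<- /eqP<-]]].
have [k -> ->] := unflip b; have [k' -> ->] := unflip c.
by rewrite sigma_le -!permM; apply: s_le.
Qed.

End FlipDiag.

(** * Standard immaculate tableaux *)

Section Tcd.

Variables (n : nat) (a : seq nat) (e : 'I_n.+1 -> tcd a).
Hypothesis ha : is_composition n.+1 a.
Hypothesis e_bij : bijective e.
Hypothesis eE : forall k, val (e k) = tcd_box a k.

Lemma in_col1_hd k : in_col1 (e k) = hd (col_of a) k.
Proof. by rewrite hd_off // /in_col1 eE. Qed.

Lemma SIT_perm (T : filling n (tcd a)) :
  T \in SIT n a <->
  exists2 U : 'S_n.+1, U \in sw_perms (col_of a) & forall k, T (e k) = U k.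
Proof.
have [g eK gK] := e_bij; have mono := @col_of_monotone n a.
rewrite inE; split=> [/and3P[stT /forallP T_row /forallP T_col] | [U swU TU]].
  have [U TU] := standard_perm e_bij stT; exists U => //.
  have U_row k k' : col_of a k = col_of a k' -> k < k' -> U k < U k'.
    move=> eq_c lt_kk'; rewrite -!TU.
    move/forallP: (T_row (e k)) => /(_ (e k')) /implyP; apply.
    rewrite !eE /= eq_c eqxx /= ltnS ltnNge; apply: contraL lt_kk' => le_o.
    by rewrite -leqNgt (col_off_leq a) eq_c eqxx le_o orbT.
  have U_rowW k k' : col_of a k = col_of a k' -> k <= k' -> U k <= U k'.
    by move=> eq_c; rewrite leq_eqVlt => /predU1P[/val_inj->//|/(U_row _ _ eq_c)/ltnW].
  apply/SigmaLP => k k' /orP[/andP[hk le_c] | /andP[/eqP eq_c]]; last exact: U_rowW.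
  have [h hd_h ch] := hd_ex (col_of a) k'.
  apply: (@leq_trans (U h)); last first.
    by apply: U_rowW => //; apply: hd_le hd_h _.
  move: le_c; rewrite leq_eqVlt => /predU1P[eq_c | lt_c].
    by apply: U_rowW; [rewrite ch|apply: hd_le hk _; rewrite ch].
  apply: ltnW; rewrite -!TU; move/forallP: (T_col (e k)) => /(_ (e h)) /implyP; apply.
  by rewrite !in_col1_hd hk hd_h !eE /= ch ltnS.
apply/and3P; split.
- have [V stV VU] := perm_filling U e_bij.
  suff -> : T = V by [].
  by apply: (filling_eq e_bij) => k; rewrite TU VU.
- apply/forallP => b; apply/forallP => c; apply/implyP.
  rewrite -(gK b) -(gK c) !eE !TU /= eqSS ltnS => /andP[/eqP eq_c lt_o].
  apply: SigmaL_lt swU _ _; last by apply: contraTneq lt_o => ->; rewrite ltnn.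
  by rewrite /sw eq_c eqxx (col_off_leq a) eq_c eqxx (ltnW lt_o) !orbT.
apply/forallP => b; apply/forallP => c; apply/implyP.
rewrite -(gK b) -(gK c) !in_col1_hd !eE !TU /= ltnS => /and3P[hb _ lt_c].
apply: SigmaL_lt swU _ _; first by rewrite /sw hb ltnW.
by apply: contraTneq lt_c => ->; rewrite ltnn.
Qed.

Lemma w_RB_perm (T : filling n (tcd a)) (U : 'S_n.+1) :
  (forall k, T (e k) = U k) -> w_RB T = ((cols_perm (col_of a))^-1 * U)%g.
Proof.
move=> TU; apply: word_perm TU _.
apply: (@pairwise_seqE _ _ e _ _ _ e_bij _ (perm_boxes _ _)
  (pairwise_boxes _ rows_RB_trans rows_RB_total)) => k k'.
rewrite !eE leqNgt cols_perm_lt /rows_RB /lt_cols /=.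
by have := col_off_leq a k' k; lia.
Qed.

Lemma w_RB_SIT : [set w_RB T | T in SIT n a] = fiber (col_of a) (cols_perm (col_of a)).
Proof.
apply/setP => s; rewrite in_fiber; apply/imsetP/idP => [[T /SIT_perm[U swU TU] ->] | sws].
  by rewrite (w_RB_perm TU) mulKVg.
have [T stT TU] := perm_filling (cols_perm (col_of a) * s)%g e_bij.
exists T; last by rewrite (w_RB_perm TU) mulKg.
by apply/SIT_perm; exists (cols_perm (col_of a) * s)%g.
Qed.

Lemma tab_perm k : tab n a (e k) = k.
Proof.
rewrite -[RHS]perm1; apply: (fill_along_perm e_bij).
apply: (@pairwise_seqE _ _ e _ _ _ e_bij _ (perm_boxes _ _)
  (pairwise_boxes _ rows_LB_trans rows_LB_total)) => {}k k'.
by rewrite !eE !perm1 (col_off_leq a) /rows_LB.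
Qed.

Lemma w_RB1_tab : w_RB1 (tab n a) = ((rows_down (col_of a))^-1)%g.
Proof.
rewrite -[RHS]mulg1 /w_RB1 -map_cat; apply: (@word_perm _ _ e).
  by move=> k; rewrite tab_perm perm1.
have := pairwise_filter_split (predC (@in_col1 (tcd a)))
  (pairwise_boxes (tcd a) rows_RB_trans rows_RB_total)
  (pairwise_boxes (tcd a) rows_RB_trans rows_RB_total).
under [X in _ ++ X]eq_filter => b do rewrite /= negbK.
apply: (pairwise_seqE e_bij) => [k k'|].
  rewrite /= !in_col1_hd !eE leqNgt rows_down_lt /lt_rows_down /rows_RB /lt_cols /=.
  have := col_off_leq a k k'; have := col_off_leq a k' k; rewrite !(hd_off _ ha).
  by case: (eqVneq (off_of a k) 0); case: (eqVneq (off_of a k') 0) => //=; lia.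
have := perm_filter_boxes (predC (@in_col1 (tcd a))) rows_RB rows_RB.
by under [X in _ ++ X]eq_filter => b do rewrite /= negbK.
Qed.

Lemma tab'_perm k : tab' n a (e k) = rows_up (col_of a) k.
Proof.
apply: (fill_along_perm e_bij).
have := pairwise_filter_split (@in_col1 (tcd a))
  (pairwise_boxes (tcd a) rows_LB_trans rows_LB_total)
  (pairwise_boxes (tcd a) rows_LT_trans rows_LT_total).
apply: (pairwise_seqE e_bij) => [{}k k'|].
  rewrite /= !in_col1_hd !eE leqNgt rows_up_lt /lt_rows_up /rows_LB /rows_LT /lt_cols /=.
  have := col_off_leq a k k'; have := col_off_leq a k' k; rewrite !(hd_off _ ha).
  by case: (eqVneq (off_of a k) 0); case: (eqVneq (off_of a k') 0) => //=; lia.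
exact: perm_filter_boxes.
Qed.

End Tcd.

Theorem proposition5p4 (n : nat) (a : seq nat) (ha : is_composition n.+1 a) :
  [/\ class_V n a =
        [set SigmaL (fill_poset (flip_fill T)) | T in ST n (flip_diag (diag_V a))],
      is_min (@le_interval n) (class_V n a)
        (intervalL (w0 (~: comp_set n a)) (w_RB (tab' n a))),
      is_max (@le_interval n) (class_V n a)
        (intervalL (w_RB1 (tab n a)) (w1 (initial_set n (n.+1 - size a)))) &
      exists f : {set 'S_n.+1} -> filling n (flip_diag (diag_V a)),
        poset_iso (class_V n a) (@le_interval n)
          (ST n (flip_diag (diag_V a))) (@le_ST n (flip_diag (diag_V a))) f].
Proof.
have [e0 [e0_bij e0E]] := tcd_enum ha.
have [e1 [e1_bij e1E]] := flip_diag_enum ha.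
set D' := flip_diag (diag_V a) in e1 e1_bij e1E *.
have mono := @col_of_monotone n a; have nwF0 := cols_perm_nw (@col_of n a).
have nwF1 := rows_down_nw mono.
have classE : class_V n a = [set fiber (col_of a) F | F in nw_perms (@col_of n a)].
  by rewrite /class_V (w_RB_SIT ha e0_bij e0E) classD_fiber.
have fiberE (T : filling n D') : T \in ST n D' ->
    SigmaL (fill_poset (flip_fill T)) = fiber (col_of a) (w_TL T) /\
    w_TL T \in nw_perms (col_of a).
  move=> /(ST_perm ha e1_bij e1E)[F nwF TF].
  by rewrite (SigmaL_flip_fill ha e1_bij e1E TF) (w_TL_perm ha e1_bij e1E TF).
have ST_ex F : F \in nw_perms (col_of a) -> exists2 T, T \in ST n D' & w_TL T = F.
  move=> nwF; have [T _ TF] := perm_filling F e1_bij.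
  exists T; last exact: (w_TL_perm ha e1_bij e1E TF).
  by apply/(ST_perm ha e1_bij e1E); exists F.
have w_TL_inj : {in ST n D' &, injective (@w_TL n D')}.
  move=> T U /(ST_perm ha e1_bij e1E)[F nwF TF] /(ST_perm ha e1_bij e1E)[G nwG UG].
  rewrite (w_TL_perm ha e1_bij e1E TF) (w_TL_perm ha e1_bij e1E UG) => eq_FG.
  by apply: (filling_eq e1_bij) => k; rewrite TF UG eq_FG.
have minE : intervalL (w0 (~: comp_set n a)) (w_RB (tab' n a)) =
    fiber (col_of a) (cols_perm (@col_of n a)).
  rewrite fiber_interval // (w_RB_perm ha e0_bij e0E (tab'_perm ha e0_bij e0E)).
  by rewrite cols_perm_w0 // w0V.
have maxE : intervalL (w_RB1 (tab n a)) (w1 (initial_set n (n.+1 - size a))) =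
    fiber (col_of a) (rows_down (@col_of n a)).
  by rewrite fiber_interval // (w_RB1_tab ha e0_bij e0E) rows_down_w1.
rewrite minE maxE classE; split.
- apply/setP => J; apply/imsetP/imsetP => [[F nwF ->] | [T /fiberE[-> nwT] ->]].
    by have [T ST_T <-] := ST_ex F nwF; exists T => //; rewrite (fiberE T ST_T).1.
  by exists (w_TL T).
- split=> [|J /imsetP[F nwF ->]]; first exact: imset_f.
  by rewrite le_interval_fiber // cols_perm_min.
- split=> [|J /imsetP[F nwF ->]]; first exact: imset_f.
  by rewrite le_interval_fiber // rows_down_max.
pose f (J : {set 'S_n.+1}) : filling n D' :=
  odflt [ffun=> ord0] [pick T in ST n D' | fiber (col_of a) (w_TL T) == J].
have fE F : F \in nw_perms (col_of a) ->
    f (fiber (col_of a) F) \in ST n D' /\ w_TL (f (fiber (col_of a) F)) = F.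
  move=> nwF; rewrite /f; case: pickP => [T /andP[ST_T /eqP eq_fib] | noT] /=.
    by split=> //; apply: (fiber_inj mono (fiberE T ST_T).2 nwF eq_fib).
  by have [T ST_T wT] := ST_ex F nwF; have := noT T; rewrite ST_T wT eqxx.
exists f; apply/poset_isoP; split.
- move=> _ _ /imsetP[F nwF ->] /imsetP[G nwG ->] /(congr1 (@w_TL n D')).
  by rewrite (fE F nwF).2 (fE G nwG).2 => ->.
- apply/setP => T; apply/imsetP/idP => [[_ /imsetP[F nwF ->] ->] | ST_T].
    exact: (fE F nwF).1.
  have nwT := (fiberE T ST_T).2; exists (fiber (col_of a) (w_TL T)).
    exact: imset_f.
  by apply: w_TL_inj; rewrite ?(fE _ nwT).1 ?(fE _ nwT).2.
move=> _ _ /imsetP[F nwF ->] /imsetP[G nwG ->].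
by rewrite /le_ST (fE F nwF).2 (fE G nwG).2 le_interval_fiber.
Qed.
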